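(* Let $A,B\in\mathrm{PSL}(2,\mathbb{R})$ be elements which generate a free Fuchsian group of rank 2, and let $\frac pq,\frac{p'}{q'}\in\mathbb{Q}_+$ with $p,q,p',q'\in\mathbb{N}_+$ and $\gcd(p,q)=\gcd(p',q')=1$. Let $R,S\in\mathrm{PSL}(2,\mathbb{R})$ be such that $R^{p/q}=A$ and $S^{p'/q'}=B$, i.e. $R^p=\widetilde A:=A^q$ and $S^{p'}=\widetilde B:=B^{q'}$. Let $\tau=\mathrm{tr}([\widetilde A,\widetilde B])$ and let $(x,y,z)=(\mathrm{tr}(R),\mathrm{tr}(S),\mathrm{tr}(RS))$ be the trace triple of $(R,S)$. Then $\langle R,S\rangle$ is a free Fuchsian group of rank 2 if and only if one of the following two conditions holds: Case F1: $\tau\le -2$ and $S_p(x)^2\cdot S_{p'}(y)^2\le\frac12-\frac14\,\tau$. Case F2: $\tau>2$ and the trace triple $(x',y',z')$ which results from applying the Trace Minimization Algorithm to $(x,y,z)$ satisfies $x'\ge 2$, $y'\ge 2$, and $z'\le -2$.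
   Context: $\mathrm{PSL}(2,\mathbb{R})=\mathrm{SL}(2,\mathbb{R})/\{\pm I_2\}$. A subgroup is discrete if it contains no convergent sequence of pairwise distinct elements; elementary if the commutator of any two of its elements of infinite order has trace $2$. A Fuchsian group is a non-elementary discrete subgroup. $[A,B]=ABA^{-1}B^{-1}$, whose trace is well defined. Trace convention: $R,S$ are represented by matrices in $\mathrm{SL}(2,\mathbb{R})$ with non-negative trace; $\mathrm{tr}(RS)$ is the trace of the product of these representatives. Chebyshev S-polynomials: $S_0(t)=0$, $S_1(t)=1$, $S_i(t)=t\,S_{i-1}(t)-S_{i-2}(t)$ for $i\ge 2$. Trace Minimization Algorithm. Input: a trace triple $(a,b,c)$ of a pair of elements of $\mathrm{PSL}(2,\mathbb{R})$ with commutator trace $\sigma=a^2+b^2+c^2-abc-2\neq 2$. (1) Permute the triple and, if necessary, switch two of the three signs (change of representatives) to get $(x,y,z)$ with $2<x\le y\le|z|$ if $\sigma<2$, and $0\le x\le y\le |z|$ if $\sigma>2$. (2) As long as the stopping condition ''$z\le \frac12 xy$ (if $\sigma<2$)'', resp. ''an entry of the triple is negative (if $\sigma>2$)'' does not hold, replace $(x,y,z)$ by the numbers $x,y,xy-z$ arranged in increasing order. (3) If $\sigma<2$, return the triple in increasing order. If $\sigma>2$, return the two non-negative entries in increasing order followed by the negative entry. *)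

(* Defs.v *)
From HB Require Import structures.
From mathcomp Require Import all_boot all_order all_algebra.
From mathcomp Require Import all_classical all_reals all_analysis.
Import Order.TTheory GRing.Theory Num.Theory.
Import numFieldNormedType.Exports.

Set Implicit Arguments.
Unset Strict Implicit.
Unset Printing Implicit Defensive.

Local Open Scope classical_set_scope.
Local Open Scope ring_scope.

(* Subgroups are classical sets, so that infinite groups are allowed. *)

Definition is_subgroup (gT : groupType) (H : set gT) : Prop :=
  [/\ H 1%g,
      forall g h, H g -> H h -> H (g * h)%g
    & forall g, H g -> H (g^-1)%g].

Definition gen (gT : groupType) (X : set gT) : set gT :=
  smallest (@is_subgroup gT) X.

Definition infinite_order (gT : groupType) (g : gT) : Prop :=
  forall n : nat, (0 < n)%N -> (g ^+ n)%g <> 1%g.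

(* Group words: the letter (i, false) stands for the i-th generator, and      *)
(* (i, true) for its inverse.                                                 *)
Definition word_eval (gT : groupType) (n : nat) (u : 'I_n -> gT)
    (w : seq ('I_n * bool)) : gT :=
  (\prod_(l <- w) (if l.2 then (u l.1)^-1 else u l.1))%g.

Definition reduced_word (n : nat) (w : seq ('I_n * bool)) : bool :=
  sorted (fun l l' => l' != (l.1, ~~ l.2)) w.

Definition free_basis (gT : groupType) (n : nat) (u : 'I_n -> gT)
    (H : set gT) : Prop :=
  H = gen (range u) /\
  forall w, reduced_word w -> word_eval u w = 1%g -> w = [::].

(* The basis is not required to be a prescribed generating tuple of H. *)
Definition free_of_rank (gT : groupType) (n : nat) (H : set gT) : Prop :=
  exists u : 'I_n -> gT, free_basis u H.

Record SL2 (K : realType) :=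
  MkSL2 { SL2_mx :> 'M[K]_2; SL2_det : \det SL2_mx == 1 }.

HB.instance Definition _ (K : realType) := [isSub for @SL2_mx K].
HB.instance Definition _ (K : realType) := [Choice of SL2 K by <:].

Section SL2Group.
Variable K : realType.
Implicit Types M N : SL2 K.

Lemma SL2_detE M : \det M = 1. Proof. exact/eqP/SL2_det. Qed.

Lemma SL2_unit M : SL2_mx M \in unitmx.
Proof. by rewrite unitmxE SL2_detE unitr1. Qed.

Definition SL2_one : SL2 K := @MkSL2 K 1%:M (introT eqP (det1 _ _)).

Fact SL2_mul_subproof M N : \det (SL2_mx M *m SL2_mx N) == 1.
Proof. by rewrite det_mulmx !SL2_detE mulr1. Qed.
Definition SL2_mul M N : SL2 K := MkSL2 (SL2_mul_subproof M N).

Fact SL2_inv_subproof M : \det (invmx (SL2_mx M)) == 1.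
Proof. by rewrite det_inv SL2_detE invr1. Qed.
Definition SL2_inv M : SL2 K := MkSL2 (SL2_inv_subproof M).

Fact SL2_opp_subproof M : \det (- SL2_mx M) == 1.
Proof. by rewrite -scaleN1r detZ SL2_detE mulr1 expr2 mulrNN mulr1. Qed.
Definition SL2_opp M : SL2 K := MkSL2 (SL2_opp_subproof M).

Fact SL2_mulA : associative SL2_mul.
Proof. by move=> M N P; apply/val_inj/mulmxA. Qed.
Fact SL2_mul1 : left_id SL2_one SL2_mul.
Proof. by move=> M; apply/val_inj/mul1mx. Qed.
Fact SL2_mulr1 : right_id SL2_one SL2_mul.
Proof. by move=> M; apply/val_inj/mulmx1. Qed.
Fact SL2_mulV : left_inverse SL2_one SL2_inv SL2_mul.
Proof. by move=> M; apply/val_inj/mulVmx/SL2_unit. Qed.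
Fact SL2_mulrV : right_inverse SL2_one SL2_inv SL2_mul.
Proof. by move=> M; apply/val_inj/mulmxV/SL2_unit. Qed.

HB.instance Definition _ :=
  isGroup.Build (SL2 K) SL2_mulA SL2_mul1 SL2_mulr1 SL2_mulV SL2_mulrV.

HB.instance Definition _ := Topological.copy (SL2 K)
  (initial_topology (@SL2_mx K)).

Definition SL2_equiv M N : bool := (M == N) || (M == SL2_opp N).

Lemma SL2_oppK : involutive SL2_opp.
Proof. by move=> M; apply/val_inj/opprK. Qed.

Fact SL2_equiv_refl : reflexive SL2_equiv.
Proof. by move=> M; rewrite /SL2_equiv eqxx. Qed.
Fact SL2_equiv_sym : symmetric SL2_equiv.
Proof.
move=> M N; rewrite /SL2_equiv eq_sym; congr (_ || _).
by rewrite -[X in X == SL2_opp N]SL2_oppK (inj_eq (inv_inj SL2_oppK)) eq_sym.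
Qed.
Fact SL2_equiv_trans : transitive SL2_equiv.
Proof.
move=> N M P /orP[] /eqP-> /orP[] /eqP->; rewrite /SL2_equiv ?SL2_oppK ?eqxx //;
by rewrite orbT.
Qed.

Canonical SL2_equiv_rel :=
  EquivRel SL2_equiv SL2_equiv_refl SL2_equiv_sym SL2_equiv_trans.
End SL2Group.

(* PSL(2,K) = SL(2,K)/{I, -I}, with the quotient topology. *)
Definition PSL2 (K : realType) : Type :=
  quotient_topology {eq_quot (@SL2_equiv_rel K)}%qT.

HB.instance Definition _ (K : realType) := Topological.on (PSL2 K).
HB.instance Definition _ (K : realType) := Quotient.on (PSL2 K).

Definition to_PSL2 (K : realType) (M : SL2 K) : PSL2 K :=
  (\pi_(PSL2 K) M)%qT.

Section PSL2Group.
Variable K : realType.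
Implicit Types (M N : SL2 K) (g h : PSL2 K).

Lemma to_PSL2_eq M N :
  to_PSL2 M = to_PSL2 N <-> M = N \/ M = SL2_opp N.
Proof.
have -> : (to_PSL2 M = to_PSL2 N) <-> SL2_equiv M N.
  exact: (rwP (@eqquotP _ (@SL2_equiv_rel K) _ M N)).
split=> [/orP[] /eqP|[]] ->; [by left|by right| |]; rewrite /SL2_equiv ?eqxx //.
by rewrite orbT.
Qed.

Lemma reprPSL2K g : to_PSL2 (repr g) = g.
Proof. exact: reprK. Qed.

Definition PSL2_one : PSL2 K := to_PSL2 1%g.
Definition PSL2_mul g h : PSL2 K := to_PSL2 (repr g * repr h)%g.
Definition PSL2_inv g : PSL2 K := to_PSL2 (repr g)^-1%g.

Lemma SL2_mulN M N : (M * SL2_opp N)%g = SL2_opp (M * N)%g.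
Proof. exact/val_inj/mulmxN. Qed.
Lemma SL2_mulNl M N : (SL2_opp M * N)%g = SL2_opp (M * N)%g.
Proof. exact/val_inj/mulNmx. Qed.
Lemma SL2_invN M : (SL2_opp M)^-1%g = SL2_opp M^-1%g.
Proof.
by apply/mulg1_eq; rewrite SL2_mulN SL2_mulNl SL2_oppK mulgV.
Qed.

Lemma repr_PSL2 M : repr (to_PSL2 M) = M \/ repr (to_PSL2 M) = SL2_opp M.
Proof. by apply/to_PSL2_eq; rewrite reprPSL2K. Qed.

Fact PSL2_mulE M N : PSL2_mul (to_PSL2 M) (to_PSL2 N) = to_PSL2 (M * N)%g.
Proof.
apply/to_PSL2_eq.
by case: (repr_PSL2 M) => ->; case: (repr_PSL2 N) => ->;
  rewrite ?SL2_mulN ?SL2_mulNl ?SL2_oppK; auto.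
Qed.

Fact PSL2_invE M : PSL2_inv (to_PSL2 M) = to_PSL2 M^-1%g.
Proof.
by apply/to_PSL2_eq; case: (repr_PSL2 M) => ->; rewrite ?SL2_invN; auto.
Qed.

Fact PSL2_mulA : associative PSL2_mul.
Proof.
move=> g h k; rewrite -[g]reprPSL2K -[h]reprPSL2K -[k]reprPSL2K.
by rewrite !PSL2_mulE mulgA.
Qed.
Fact PSL2_mul1 : left_id PSL2_one PSL2_mul.
Proof. by move=> g; rewrite -[g]reprPSL2K PSL2_mulE mul1g. Qed.
Fact PSL2_mulr1 : right_id PSL2_one PSL2_mul.
Proof. by move=> g; rewrite -[g]reprPSL2K PSL2_mulE mulg1. Qed.
Fact PSL2_mulV : left_inverse PSL2_one PSL2_inv PSL2_mul.
Proof. by move=> g; rewrite -[g]reprPSL2K PSL2_invE PSL2_mulE mulVg. Qed.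
Fact PSL2_mulrV : right_inverse PSL2_one PSL2_inv PSL2_mul.
Proof. by move=> g; rewrite -[g]reprPSL2K PSL2_invE PSL2_mulE mulgV. Qed.

HB.instance Definition _ := isGroup.Build (PSL2 K)
  PSL2_mulA PSL2_mul1 PSL2_mulr1 PSL2_mulV PSL2_mulrV.

Lemma to_PSL2M M N : to_PSL2 (M * N)%g = (to_PSL2 M * to_PSL2 N)%g.
Proof. by rewrite -PSL2_mulE. Qed.

Lemma to_PSL2V M : to_PSL2 M^-1%g = (to_PSL2 M)^-1%g.
Proof. by rewrite -PSL2_invE. Qed.

Definition SL2_tr M : K := \tr (SL2_mx M).

(* Trace of the commutator [g, h] = g h g^-1 h^-1, which is not MathComp's   *)
(* [~ g, h] = g^-1 h^-1 g h.                                                  *)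
Definition comm_tr g h : K :=
  SL2_tr (repr g * repr h * (repr g)^-1 * (repr h)^-1)%g.

Lemma comm_trE M N :
  comm_tr (to_PSL2 M) (to_PSL2 N) = SL2_tr (M * N * M^-1 * N^-1)%g.
Proof.
rewrite /comm_tr; case: (repr_PSL2 M) => ->; case: (repr_PSL2 N) => -> //;
by rewrite ?SL2_invN !(SL2_mulN, SL2_mulNl) ?SL2_oppK.
Qed.

Definition discrete (G : set (PSL2 K)) : Prop :=
  ~ exists (u : nat -> PSL2 K) (l : PSL2 K),
      [/\ forall n, G (u n), injective u & u @ \oo --> l].

Definition elementary (G : set (PSL2 K)) : Prop :=
  forall g h, G g -> G h -> infinite_order g -> infinite_order h ->
    comm_tr g h = 2.

Definition fuchsian (G : set (PSL2 K)) : Prop :=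
  [/\ is_subgroup G, discrete G & ~ elementary G].

Definition free_fuchsian (n : nat) (G : set (PSL2 K)) : Prop :=
  fuchsian G /\ free_of_rank n G.

End PSL2Group.

(* Chebyshev S-polynomials, indexed so that chebS n has degree n - 1. *)
Fixpoint chebS (R : nzRingType) (n : nat) : {poly R} :=
  match n with
  | 0 => 0
  | n1.+1 => match n1 with
             | 0 => 1
             | n2.+1 => 'X * chebS R n1 - chebS R n2
             end
  end.

Section TraceMinimization.
Variable K : realType.
Implicit Types (a b c x y z sigma : K) (t : K * K * K).

Definition comm_tr_of_triple t : K :=
  let: (a, b, c) := t in a ^+ 2 + b ^+ 2 + c ^+ 2 - a * b * c - 2.

Definition sort3 a b c : K * K * K :=
  let s := sort <=%R [:: a; b; c] in (s`_0, s`_1, s`_2).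

(* The commutator trace sigma is an invariant of the algorithm, so it is     *)
(* computed once, from the input.                                             *)

Definition tma_start sigma t t0 : Prop :=
  (exists a b c,
     perm_eq [:: t.1.1; t.1.2; t.2] [:: a; b; c] /\
     t0 \in [:: (a, b, c); (- a, - b, c); (- a, b, - c); (a, - b, - c)]) /\
  let: (x, y, z) := t0 in
  [/\ sigma < 2 -> 2 < x, sigma > 2 -> 0 <= x, x <= y & y <= `|z|].

Definition tma_stop sigma t : bool :=
  let: (x, y, z) := t in
  if sigma < 2 then z <= 2^-1 * (x * y) else [|| x < 0, y < 0 | z < 0].

Definition tma_step t : K * K * K :=
  let: (x, y, z) := t in sort3 x y (x * y - z).

Inductive tma_loop sigma : K * K * K -> K * K * K -> Prop :=
| TmaStop t : tma_stop sigma t -> tma_loop sigma t t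
| TmaStep t t' : ~~ tma_stop sigma t -> tma_loop sigma (tma_step t) t' ->
    tma_loop sigma t t'.

Definition tma_output sigma t : K * K * K :=
  let: (x, y, z) := t in
  if sigma < 2 then sort3 x y z
  else let s := sort <=%R [:: x; y; z] in
       let r := [seq v <- s | 0 <= v] ++ [seq v <- s | v < 0] in
       (r`_0, r`_1, r`_2).

(* tma t t' : the Trace Minimization Algorithm terminates on the input t and *)
(* returns t'.                                                                *)
Definition tma t t' : Prop :=
  let sigma := comm_tr_of_triple t in
  sigma != 2 /\
  exists t0 t1, [/\ tma_start sigma t t0, tma_loop sigma t0 t1
                  & t' = tma_output sigma t1].
End TraceMinimization.

(* Main.v *)
Require Import Defs.
From mathcomp Require Import all_boot all_order all_algebra.
From mathcomp Require Import all_classical all_reals all_analysis.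
From mathcomp Require Import ring lra.
Import Order.TTheory GRing.Theory Num.Theory.
Import numFieldNormedType.Exports.
Local Open Scope classical_set_scope.
Local Open Scope ring_scope.
Set Implicit Arguments.
Unset Strict Implicit.
Unset Printing Implicit Defensive.

(** Put sigma = tr [R, S].  Since R^p = S_p(x) R - S_(p-1)(x), the matrices
    R^p and S^p' satisfy tau - 2 = S_p(x)^2 S_p'(y)^2 (sigma - 2), so that F1 says
    sigma <= -2 and F2 says sigma > 2 together with the condition on the
    minimized triple.

    Necessity: a discrete torsion-free group contains no elliptic element, so all
    its traces have absolute value at least 2.  Applied to the commutator this
    gives |sigma| >= 2, and sigma = 2 would make the group elementary.  If
    sigma > 2, every flip z -> xy - z lowers the sum of the triple by an amount
    bounded below in terms of sigma, so the algorithm reaches a negative entry;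
    all entries being traces of elements of the group, they are at least 2 in
    absolute value.

    Sufficiency: a ping-pong argument on the projective line, with four arcs
    bounded by the vertices of an ideal quadrilateral.  For sigma <= -2 the
    quadrilateral is a fundamental domain of a one-holed torus; for traces
    x, y >= 2 and tr(RS) <= -2 it is one of a pair of pants.  A nontrivial
    reduced word moves a chosen point of one of the arcs out of this arc, which
    gives freeness and, applied to quotients of consecutive terms of a convergent
    sequence, discreteness. *)

(** * Reduced words *)

Section Words.
Variable gT : groupType.
Local Open Scope group_scope.
Implicit Types (X Y H : set gT) (g h : gT).

Lemma gen_subgroup X : is_subgroup (gen X).
Proof.
split=> [H [[]]//|g h Xg Xh H HX|g Xg H HX].
  by case: HX (Xg _ HX) (Xh _ HX) => -[_ HM _] _; apply: HM.
by case: HX (Xg _ HX) => -[_ _ HV] _; apply: HV.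
Qed.

Lemma sub_gen X : X `<=` gen X.
Proof. exact: sub_gen_smallest. Qed.

Lemma gen_sub X H : is_subgroup H -> X `<=` H -> gen X `<=` H.
Proof. exact: smallest_sub. Qed.

Lemma gen_eq X Y : X `<=` gen Y -> Y `<=` gen X -> gen X = gen Y.
Proof. by move=> XY YX; apply/seteqP; split; apply: gen_sub => //; exact: gen_subgroup. Qed.

Lemma is_subgroupX H g n : is_subgroup H -> H g -> H (g ^+ n).
Proof. by case=> H1 HM _ Hg; elim: n => [|n IHn]; rewrite ?expg0 ?expgS //; apply: HM. Qed.

Section Letters.
Variable n : nat.
Implicit Types (l : 'I_n * bool) (w : seq ('I_n * bool)) (u : 'I_n -> gT).

Definition letter_inv l : 'I_n * bool := (l.1, ~~ l.2).

Definition letter_eval u l : gT := if l.2 then (u l.1)^-1 else u l.1.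

Lemma letter_invK : involutive letter_inv.
Proof. by case=> i b; rewrite /letter_inv /= negbK. Qed.

Lemma letter_inv_neq l : letter_inv l != l.
Proof. by case: l => i [] ; rewrite /letter_inv /eq_op /= andbF. Qed.

Lemma letter_eval_inv u l : letter_eval u (letter_inv l) = (letter_eval u l)^-1.
Proof. by case: l => i []; rewrite /letter_eval /= ?invgK. Qed.

Lemma word_eval_nil u : word_eval u [::] = 1.
Proof. by rewrite /word_eval big_nil. Qed.

Lemma word_eval_cons u l w : word_eval u (l :: w) = letter_eval u l * word_eval u w.
Proof. by rewrite /word_eval big_cons. Qed.

Lemma word_eval_cat u w w' : word_eval u (w ++ w') = word_eval u w * word_eval u w'.
Proof. by rewrite /word_eval big_cat. Qed.

Lemma word_eval_nseq u w m : word_eval u (flatten (nseq m w)) = word_eval u w ^+ m.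
Proof.
elim: m => [|m IHm] /=; first by rewrite word_eval_nil.
by rewrite word_eval_cat IHm expgS.
Qed.

Lemma word_eval_rev u w : word_eval u (rev (map letter_inv w)) = (word_eval u w)^-1.
Proof.
elim: w => [|l w IHw]; first by rewrite word_eval_nil invg1.
rewrite /= rev_cons -cats1 word_eval_cat IHw !word_eval_cons word_eval_nil mulg1.
by rewrite letter_eval_inv invgM.
Qed.

Lemma gen_range_word u g : gen (range u) g -> exists w, g = word_eval u w.
Proof.
apply: (@gen_sub _ [set g | exists w, g = word_eval u w]); last first.
  by move=> _ [i _ <-]; exists [:: (i, false)]; rewrite word_eval_cons word_eval_nil mulg1.
split=> [|_ _ [w ->] [w' ->]|_ [w ->]].
- by exists [::]; rewrite word_eval_nil.
- by exists (w ++ w'); rewrite word_eval_cat.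
- by exists (rev (map letter_inv w)); rewrite word_eval_rev.
Qed.

Lemma reduced_cons l l' w :
  reduced_word (l :: l' :: w) = (l' != letter_inv l) && reduced_word (l' :: w).
Proof. by []. Qed.

Lemma reduced_behead l w : reduced_word (l :: w) -> reduced_word w.
Proof. by case: w => // l' w; rewrite reduced_cons => /andP[]. Qed.

Lemma reduced_form u w : exists2 w', reduced_word w' & word_eval u w' = word_eval u w.
Proof.
elim: w => [|l w [w' redw' IHw]]; first by exists [::].
rewrite word_eval_cons -IHw.
case: w' redw' {IHw} => [|l' w'] redw'; first by exists [:: l]; rewrite ?word_eval_cons.
have [el'|nl'] := eqVneq l' (letter_inv l); last first.
  by exists [:: l, l' & w']; rewrite ?reduced_cons ?nl' // !word_eval_cons.
exists w'; first exact: reduced_behead redw'.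
by rewrite word_eval_cons el' letter_eval_inv mulVKg.
Qed.

(** Induction on the length. If the first letter is not the inverse of the last one, the
    concatenation of m copies is still reduced, so freeness forces it to be empty, which it is not.
    Otherwise conjugation by the last letter removes both end letters. *)
Lemma reduced_word_torsion u w m :
    (forall w, reduced_word w -> word_eval u w = 1 -> w = [::]) ->
  reduced_word w -> (0 < m)%N -> word_eval u w ^+ m = 1 -> word_eval u w = 1.
Proof.
move=> free_u redw m0; have [k lew] := ubnP (size w).
elim: k w lew redw => // k IHk [|l w] lew redw wm; first by rewrite word_eval_nil.
have [el|nl] := eqVneq l (letter_inv (last l w)); last first.
  have red_flatten j l' : l != letter_inv l' ->
      path (fun l l' => l' != letter_inv l) l' (flatten (nseq j (l :: w))).
    elim: j l' => //= j IHj l' ->; rewrite cat_path /=; apply/andP; split=> //.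
    exact: IHj.
  have red0 : reduced_word (flatten (nseq m (l :: w))).
    rewrite -(prednK m0) /=; rewrite cat_path; apply/andP; split=> //.
    exact: red_flatten.
  have /(free_u _ red0) : word_eval u (flatten (nseq m (l :: w))) = 1.
    by rewrite word_eval_nseq.
  by rewrite -(prednK m0).
case/lastP: w => [|w l'] in lew redw wm el *.
  by move: el (letter_inv_neq l) => /= <-; rewrite eqxx.
rewrite last_rcons in el.
have evalE : word_eval u (l :: rcons w l') = (letter_eval u l') ^-1 * word_eval u w * letter_eval u l'.
  by rewrite -cats1 word_eval_cons word_eval_cat el letter_eval_inv word_eval_cons word_eval_nil mulg1 mulgA.
have conjX j : ((letter_eval u l')^-1 * word_eval u w * letter_eval u l') ^+ j =
     (letter_eval u l')^-1 * word_eval u w ^+ j * letter_eval u l'.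
  elim: j => [|j IHj]; first by rewrite !expg0 mulg1 mulVg.
  by rewrite !expgS IHj !mulgA mulgK.
have w1 : word_eval u w = 1.
  apply: IHk.
  - by move: lew; rewrite /= size_rcons !ltnS; apply: ltnW.
  - by move: redw => /reduced_behead; rewrite /reduced_word -cats1 => /cat_sorted2[].
  - move: wm; rewrite evalE conjX => /(congr1 (fun g => letter_eval u l' * g * (letter_eval u l')^-1)).
    by rewrite mulg1 mulgV !mulgA mulgK mulgV mul1g.
by rewrite evalE w1 mulg1 mulVg.
Qed.

Lemma free_torsion_free H g m :
  free_of_rank n H -> H g -> (0 < m)%N -> g ^+ m = 1 -> g = 1.
Proof.
case=> u [-> free_u] /gen_range_word[w ->] m0.
have [w' redw' <-] := reduced_form u w.
exact: reduced_word_torsion.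
Qed.

End Letters.
End Words.

(** * Matrices of size 2 and trace identities *)

Section Matrix2.
Variable R : comNzRingType.
Implicit Types (a b c d : R) (M N : 'M[R]_2).

Definition mx2 a b c d : 'M[R]_2 :=
  \matrix_(i, j) if i == 0 then if j == 0 then a else b
                 else if j == 0 then c else d.

Definition rv2 a b : 'rV[R]_2 := \row_j if j == 0 then a else b.

Lemma ord2P (i : 'I_2) : i = 0 \/ i = 1.
Proof. by case: i => [[|[|]]] // ?; [left|right]; apply/val_inj. Qed.

Lemma mx2E M : M = mx2 (M 0 0) (M 0 1) (M 1 0) (M 1 1).
Proof. by apply/matrixP => i j; rewrite mxE; case: (ord2P i) (ord2P j) => -> [] ->. Qed.

Lemma rv2E (v : 'rV[R]_2) : v = rv2 (v 0 0) (v 0 1).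
Proof. by apply/rowP => j; rewrite mxE; case: (ord2P j) => ->. Qed.

Lemma sum2 (F : 'I_2 -> R) : \sum_i F i = F 0 + F 1.
Proof. by rewrite big_ord_recl big_ord1; congr (_ + F _); apply/val_inj. Qed.

Lemma mulmx2 a b c d a' b' c' d' :
  mx2 a b c d *m mx2 a' b' c' d' =
  mx2 (a * a' + b * c') (a * b' + b * d') (c * a' + d * c') (c * b' + d * d').
Proof.
by apply/matrixP => i j; rewrite !mxE sum2 !mxE; case: (ord2P i) (ord2P j) => -> [] ->.
Qed.

Lemma mulrv2 a b a' b' c' d' :
  rv2 a b *m mx2 a' b' c' d' = rv2 (a * a' + b * c') (a * b' + b * d').
Proof. by apply/rowP => j; rewrite !mxE sum2 !mxE; case: (ord2P j) => ->. Qed.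

Lemma addmx2 a b c d a' b' c' d' :
  mx2 a b c d + mx2 a' b' c' d' = mx2 (a + a') (b + b') (c + c') (d + d').
Proof. by apply/matrixP => i j; rewrite !mxE; case: (ord2P i) (ord2P j) => -> [] ->. Qed.

Lemma oppmx2 a b c d : - mx2 a b c d = mx2 (- a) (- b) (- c) (- d).
Proof. by apply/matrixP => i j; rewrite !mxE; case: (ord2P i) (ord2P j) => -> [] ->. Qed.

Lemma scalemx2 k a b c d : k *: mx2 a b c d = mx2 (k * a) (k * b) (k * c) (k * d).
Proof. by apply/matrixP => i j; rewrite !mxE; case: (ord2P i) (ord2P j) => -> [] ->. Qed.

Lemma scalerv2 k a b : k *: rv2 a b = rv2 (k * a) (k * b).
Proof. by apply/rowP => j; rewrite !mxE; case: (ord2P j) => ->. Qed.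

Lemma scalar_mx2 k : k%:M = mx2 k 0 0 k.
Proof. by apply/matrixP => i j; rewrite !mxE; case: (ord2P i) (ord2P j) => -> [] ->. Qed.

Lemma tr_mx2 a b c d : \tr (mx2 a b c d) = a + d.
Proof. by rewrite /mxtrace sum2 !mxE. Qed.

Lemma det_mx2 a b c d : \det (mx2 a b c d) = a * d - b * c.
Proof.
rewrite (expand_det_row _ 0) sum2 /cofactor !det_mx11 !mxE /= expr0 expr1; ring.
Qed.

Lemma rv2_inj a b a' b' : rv2 a b = rv2 a' b' -> a = a' /\ b = b'.
Proof. by move=> /rowP eqv; have := eqv 0; have := eqv 1; rewrite !mxE. Qed.

Definition mx2_simp := (mulmx2, mulrv2, addmx2, oppmx2, scalemx2, scalerv2, scalar_mx2, tr_mx2, det_mx2).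

End Matrix2.

Lemma mx2_inv (F : fieldType) (a b c d : F) :
  a * d - b * c = 1 -> invmx (mx2 a b c d) = mx2 d (- b) (- c) a.
Proof.
move=> det1.
have unitM : mx2 a b c d \in unitmx by rewrite unitmxE det_mx2 det1 unitr1.
apply: (can_inj (mulKmx unitM)); rewrite mulmxV // mulmx2 scalar_mx2.
by congr mx2; rewrite -?det1; ring.
Qed.

Lemma row2_dependent (F : fieldType) (v w : 'rV[F]_2) :
  v != 0 -> (exists c, w = c *: v) \/ mx2 (v 0 0) (v 0 1) (w 0 0) (w 0 1) \in unitmx.
Proof.
rewrite [v]rv2E [w]rv2E; move: (v 0 0) (v 0 1) (w 0 0) (w 0 1) => p q r s v0.
rewrite !mxE /= unitmxE det_mx2 unitfE.
have [/eqP det0|] := eqVneq (p * s - q * r) 0; last by right.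
left; have [p0|p0] := eqVneq p 0; last first.
  exists (r / p); rewrite scalerv2; congr rv2; first by field.
  by apply: (mulfI p0); move: det0; rewrite subr_eq0 => /eqP->; field.
have q0 : q != 0 by apply: contraNneq v0 => q0; apply/eqP/rowP => j; rewrite !mxE p0 q0 if_same.
move: det0; rewrite p0 mul0r sub0r oppr_eq0 mulf_eq0 (negbTE q0) /= => /eqP->.
by exists (s / q); rewrite scalerv2; congr rv2; field.
Qed.

(** * Trace identities, powers, and commutators of trace 2 in SL(2,K) *)

Section SL2Theory.
Variable K : realType.
Implicit Types (M N : SL2 K) (g h : PSL2 K).

Lemma SL2_mxM M N : SL2_mx (M * N)%g = SL2_mx M *m SL2_mx N.
Proof. by []. Qed.

Lemma SL2_mxV M : SL2_mx (M^-1)%g = invmx (SL2_mx M).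
Proof. by []. Qed.

Lemma SL2_mxN M : SL2_mx (SL2_opp M) = - SL2_mx M.
Proof. by []. Qed.

Lemma SL2_mx1 : SL2_mx (1%g : SL2 K) = 1%:M.
Proof. by []. Qed.

Lemma SL2_mx2 M : exists a b c d, SL2_mx M = mx2 a b c d /\ a * d - b * c = 1.
Proof.
exists (SL2_mx M 0 0), (SL2_mx M 0 1), (SL2_mx M 1 0), (SL2_mx M 1 1).
split; first exact: mx2E.
by rewrite -det_mx2 -mx2E SL2_detE.
Qed.

Lemma SL2_trV M : SL2_tr (M^-1)%g = SL2_tr M.
Proof.
rewrite /SL2_tr SL2_mxV; have [a [b [c [d [-> det1]]]]] := SL2_mx2 M.
by rewrite mx2_inv // !mx2_simp addrC.
Qed.

Lemma SL2_trN M : SL2_tr (SL2_opp M) = - SL2_tr M.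
Proof. by rewrite /SL2_tr SL2_mxN raddfN. Qed.

Lemma SL2_trMC M N : SL2_tr (M * N)%g = SL2_tr (N * M)%g.
Proof. exact: mxtrace_mulC. Qed.

(** By Cayley-Hamilton, N^-1 = tr(N) - N. This identity is the source of the move z -> xy - z of the
    algorithm. *)
Lemma SL2_trMV M N :
  SL2_tr (M * N^-1)%g = SL2_tr M * SL2_tr N - SL2_tr (M * N)%g.
Proof.
rewrite /SL2_tr !SL2_mxM SL2_mxV.
have [a [b [c [d [-> _]]]]] := SL2_mx2 M; have [e [f [g [h [-> det1]]]]] := SL2_mx2 N.
by rewrite mx2_inv // !mx2_simp; ring.
Qed.

(** The Fricke identity. It is a polynomial identity once the terms of lower degree are multiplied
    by the determinants, which equal 1. *)
Lemma SL2_tr_comm M N :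
  SL2_tr (M * N * M^-1 * N^-1)%g =
  comm_tr_of_triple (SL2_tr M, SL2_tr N, SL2_tr (M * N)%g).
Proof.
rewrite /SL2_tr !SL2_mxM !SL2_mxV /comm_tr_of_triple.
have [a [b [c [d [-> detM]]]]] := SL2_mx2 M; have [e [f [g [h [-> detN]]]]] := SL2_mx2 N.
rewrite !mx2_inv // !mx2_simp.
have -> : 2 = 2 * (a * d - b * c) * (e * h - f * g) by rewrite detM detN !mulr1.
have -> : (a + d) ^+ 2 = (a + d) ^+ 2 * (e * h - f * g) by rewrite detN mulr1.
have -> : (e + h) ^+ 2 = (e + h) ^+ 2 * (a * d - b * c) by rewrite detM mulr1.
ring.
Qed.

(** Since MN - NM = ([M,N] - 1) NM, its determinant is that of C - 1 with C = [M,N], which is 2 - tr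
    C. Unlike the group commutator, MN - NM is bilinear and ignores scalar summands. *)
Lemma SL2_det_comm M N :
  \det (SL2_mx M *m SL2_mx N - SL2_mx N *m SL2_mx M) =
  2 - SL2_tr (M * N * M^-1 * N^-1)%g.
Proof.
rewrite SL2_tr_comm /SL2_tr !SL2_mxM /comm_tr_of_triple.
have [a [b [c [d [-> detM]]]]] := SL2_mx2 M; have [e [f [g [h [-> detN]]]]] := SL2_mx2 N.
rewrite !mx2_simp.
have -> : 2 = 2 * (a * d - b * c) * (e * h - f * g) by rewrite detM detN !mulr1.
have -> : (a + d) ^+ 2 = (a + d) ^+ 2 * (e * h - f * g) by rewrite detN mulr1.
have -> : (e + h) ^+ 2 = (e + h) ^+ 2 * (a * d - b * c) by rewrite detM mulr1.
ring.
Qed.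

Lemma SL2_sqr M : SL2_mx M *m SL2_mx M = SL2_tr M *: SL2_mx M - 1%:M.
Proof.
rewrite /SL2_tr; have [a [b [c [d [-> det1]]]]] := SL2_mx2 M.
rewrite !mx2_simp; congr mx2; rewrite -?det1; ring.
Qed.

Lemma chebSS (x : K) n :
  (chebS K n.+2).[x] = x * (chebS K n.+1).[x] - (chebS K n).[x].
Proof. by rewrite [chebS K n.+2]/(_ - _) hornerD hornerN hornerM hornerX. Qed.

Lemma SL2_mxX M n :
  SL2_mx (M ^+ n.+1)%g =
  (chebS K n.+1).[SL2_tr M] *: SL2_mx M - (chebS K n).[SL2_tr M] *: 1%:M.
Proof.
elim: n => [|n IHn]; first by rewrite expg1 /= !hornerE scale1r scale0r subr0.
rewrite expgS SL2_mxM IHn mulmxBr -!scalemxAr mulmx1 SL2_sqr chebSS.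
by rewrite scalerBr scalerBl scalerA mulrC addrAC.
Qed.

(** The powers are s M - s' and t N - t', so their additive commutator is st (MN - NM), and its
    determinant is multiplied by (st)^2. *)
Lemma comm_tr_expg M N p q :
  SL2_tr (M ^+ p.+1 * N ^+ q.+1 * (M ^+ p.+1)^-1 * (N ^+ q.+1)^-1)%g - 2 =
  (chebS K p.+1).[SL2_tr M] ^+ 2 * (chebS K q.+1).[SL2_tr N] ^+ 2 *
  (SL2_tr (M * N * M^-1 * N^-1)%g - 2).
Proof.
apply: oppr_inj; rewrite -mulrN !opprB -!SL2_det_comm !SL2_mxX.
move: (chebS K p.+1).[_] (chebS K q.+1).[_] (chebS K p).[_] (chebS K q).[_] => s t s' t'.
have [a [b [c [d [-> _]]]]] := SL2_mx2 M; have [e [f [g [h [-> _]]]]] := SL2_mx2 N.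
rewrite !mx2_simp; ring.
Qed.

Lemma chebS_ge n (x : K) : 2 <= x -> n%:R <= (chebS K n).[x].
Proof.
move=> x2.
(* The induction needs the stronger claim that consecutive values grow by at least 1. *)
suff [] : n%:R <= (chebS K n).[x] /\ (chebS K n).[x] + 1 <= (chebS K n.+1).[x] by [].
elim: n => [|n [IH1 IH2]]; first by rewrite /= !hornerE; split; lra.
have n0 : 0 <= n%:R :> K by [].
rewrite chebSS -natr1; move: IH1 IH2.
by move: (chebS K n.+1).[x] (chebS K n).[x] => s t IH1 IH2; split; nra.
Qed.

Lemma common_eigenvector_comm_tr M N (v : 'rV[K]_2) l m :
  v != 0 -> v *m SL2_mx M = l *: v -> v *m SL2_mx N = m *: v ->
  SL2_tr (M * N * M^-1 * N^-1)%g = 2.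
Proof.
move=> v0 vM vN; apply/eqP; rewrite eq_sym -subr_eq0 -SL2_det_comm; apply/det0P.
exists v => //; rewrite mulmxBr !mulmxA vM vN -!scalemxAl vM vN !scalerA.
by rewrite mulrC subrr.
Qed.

(** X = MN - NM is singular. When it is nonzero, its left kernel is a line, and MXM = X = NXN makes
    this line invariant under M and N. *)
Lemma comm_tr2_cases M N :
  SL2_tr (M * N * M^-1 * N^-1)%g = 2 ->
  SL2_mx M *m SL2_mx N = SL2_mx N *m SL2_mx M \/
  exists v : 'rV[K]_2, exists l m,
    [/\ v != 0, v *m SL2_mx M = l *: v & v *m SL2_mx N = m *: v].
Proof.
move=> tr2; set X := SL2_mx M *m SL2_mx N - SL2_mx N *m SL2_mx M.
have [X0|X0] := eqVneq X 0; [left|right].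
  by apply/eqP; rewrite -subr_eq0 -/X X0.
have /eqP/det0P[v v0 vX] : \det X = 0 by rewrite SL2_det_comm tr2 subrr.
have MXM : SL2_mx M *m X *m SL2_mx M = X /\ SL2_mx N *m X *m SL2_mx N = X.
  rewrite /X; have [a [b [c [d [-> detM]]]]] := SL2_mx2 M.
  have [e [f [g [h [-> detN]]]]] := SL2_mx2 N.
  split; rewrite -[RHS]scale1r; [rewrite -detM|rewrite -detN];
    by rewrite !mx2_simp; congr mx2; ring.
clearbody X.
have eigen (P : SL2 K) : SL2_mx P *m X *m SL2_mx P = X -> exists l, v *m SL2_mx P = l *: v.
  move=> PXP; case: (row2_dependent (v *m SL2_mx P) v0) => // unitV.
  (* If v and vP were independent, both would lie in the left kernel of X, so X would vanish. *)
  case/eqP: X0; apply: (can_inj (mulKmx unitV)); rewrite mulmx0.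
  have vPX : v *m SL2_mx P *m X = 0.
    apply: (can_inj (mulmxK (SL2_unit P))).
    by rewrite mul0mx -!mulmxA [SL2_mx P *m (X *m _)]mulmxA PXP.
  have rowX (r : 'rV_2) : r *m X = 0 -> forall j, r 0 0 * X 0 j + r 0 1 * X 1 j = 0.
    by move=> rX j; have := congr1 (fun w : 'rV_2 => w 0 j) rX; rewrite !mxE sum2.
  move: (v *m SL2_mx P) vPX => w wX; apply/matrixP => i j; rewrite !mxE sum2 !mxE.
  by case: (ord2P i) => -> /=; [exact: rowX vX j|exact: rowX wX j].
have [l vM] := eigen _ MXM.1; have [m vN] := eigen _ MXM.2.
by exists v, l, m.
Qed.

End SL2Theory.

(** * Elementary groups and elliptic elements *)

Section Fuchsian.
Variable K : realType.
Implicit Types (M N : SL2 K) (g h : PSL2 K) (G : set (PSL2 K)).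

Lemma to_PSL2X M n : to_PSL2 (M ^+ n)%g = (to_PSL2 M ^+ n)%g.
Proof. by elim: n => [|n IHn]; rewrite ?expg0 ?expgS // to_PSL2M IHn. Qed.

Lemma to_PSL2N M : to_PSL2 (SL2_opp M) = to_PSL2 M.
Proof. by apply/to_PSL2_eq; right. Qed.

Lemma to_PSL2_eq1 M : to_PSL2 M = 1%g <-> M = 1%g \/ M = SL2_opp 1%g.
Proof. exact: (to_PSL2_eq M 1%g). Qed.

Lemma is_subgroup_line (v : 'rV[K]_2) : v != 0 ->
  is_subgroup [set g | exists M, to_PSL2 M = g /\ exists l, v *m SL2_mx M = l *: v].
Proof.
move=> v0; split=> [|_ _ [M [<- [l vM]]] [N [<- [m vN]]]|_ [M [<- [l vM]]]].
- by exists 1%g; split=> //; exists 1; rewrite SL2_mx1 mulmx1 scale1r.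
- exists (M * N)%g; rewrite to_PSL2M; split=> //; exists (l * m).
  by rewrite SL2_mxM mulmxA vM -scalemxAl vN scalerA.
- exists M^-1%g; rewrite to_PSL2V; split=> //; exists l^-1.
  have vE : v = l *: (v *m SL2_mx (M^-1)%g).
    by rewrite scalemxAl -vM SL2_mxV mulmxK // SL2_unit.
  have l0 : l != 0 by apply: contraNneq v0 => l0; rewrite vE l0 scale0r.
  by rewrite [in RHS]vE scalerA mulVf // scale1r.
Qed.

Lemma is_subgroup_cent N :
  is_subgroup [set g | exists M, to_PSL2 M = g /\ (M * N = N * M)%g].
Proof.
split=> [|_ _ [M [<- MN]] [M' [<- MN']]|_ [M [<- MN]]].
- by exists 1%g; rewrite mul1g mulg1.
- by exists (M * M')%g; rewrite to_PSL2M -mulgA MN' !mulgA MN.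
- by exists M^-1%g; rewrite to_PSL2V; split=> //; apply: (mulgI M); rewrite mulVKg mulgA MN mulgK.
Qed.

Lemma commute_repr M M' N : to_PSL2 M = to_PSL2 M' -> (M * N = N * M)%g -> (M' * N = N * M')%g.
Proof.
move/to_PSL2_eq => [->//|->]; rewrite SL2_mulN SL2_mulNl.
by move/(congr1 (@SL2_opp K)); rewrite !SL2_oppK.
Qed.

(** The two cases for the generators pass to the whole group: either any two lifts commute and the
    commutator has the trace of the identity, or all elements preserve a common line. *)
Lemma comm_tr2_elementary g h : comm_tr g h = 2 -> elementary (gen [set g; h]).
Proof.
rewrite -[g]reprPSL2K -[h]reprPSL2K comm_trE.
move: (repr g) (repr h) => M N /comm_tr2_cases[MN|[v [l [m [v0 vM vN]]]]] g1 h1 G1 H1 _ _.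
- have {}MN : (M * N = N * M)%g by apply/val_inj.
  have cent (P : SL2 K) f : (M * P = P * M)%g -> (N * P = P * N)%g ->
      gen [set to_PSL2 M; to_PSL2 N] f -> (repr f * P = P * repr f)%g.
    move=> MP NP Gf.
    have [Q [Qf QP]] : exists Q, to_PSL2 Q = f /\ (Q * P = P * Q)%g.
      apply: (gen_sub (is_subgroup_cent P)) Gf => _ [] ->; first by exists M.
      by exists N.
    by apply: (commute_repr _ QP); rewrite Qf reprPSL2K.
  (* The centralizer argument is used twice: first [h1] commutes with both generators, then [g1]
     commutes with [h1]. *)
  have H1M : (repr h1 * M = M * repr h1)%g by apply: cent.
  have H1N : (repr h1 * N = N * repr h1)%g by apply: cent.
  have -> : comm_tr g1 h1 = SL2_tr (1%g : SL2 K).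
    by rewrite /comm_tr (cent _ g1) // mulgK mulgV.
  by rewrite /SL2_tr SL2_mx1 mxtrace1.
- have line f : gen [set to_PSL2 M; to_PSL2 N] f ->
      exists P, to_PSL2 P = f /\ exists l, v *m SL2_mx P = l *: v.
    apply: (gen_sub (is_subgroup_line v0)) => _ [] ->; first by exists M; split=> //; exists l.
    by exists N; split=> //; exists m.
  have [P [<- [lP vP]]] := line _ G1; have [Q [<- [lQ vQ]]] := line _ H1.
  by rewrite comm_trE; apply: common_eigenvector_comm_tr vP vQ.
Qed.

(** This is det(M^(n+1)) = 1 for M of trace t, written in the coefficients of M^(n+1) in terms of M
    and 1; the recursion preserves the form. *)
Lemma chebS_conic (t : K) n :
  (chebS K n.+1).[t] ^+ 2 - t * (chebS K n.+1).[t] * (chebS K n).[t] + (chebS K n).[t] ^+ 2 = 1.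
Proof.
elim: n => [|n IHn]; first by rewrite /= !hornerE; ring.
by rewrite -IHn chebSS; ring.
Qed.

(** For |t| < 2 the conic through the pairs of consecutive values is an ellipse; completing the
    square bounds each coordinate. *)
Lemma chebS_bounded (t : K) n : `|t| < 2 -> `|(chebS K n).[t]| <= 1 + (1 - t ^+ 2 / 4)^-1.
Proof.
rewrite ltr_norml => /andP[t1 t2].
have d0 : 0 < 1 - t ^+ 2 / 4.
  suff : 0 < (t + 2) * (2 - t) by lra.
  by apply: mulr_gt0; lra.
set D := _^-1; have D0 : 0 < D by rewrite invr_gt0.
have DE : D * (1 - t ^+ 2 / 4) = 1 by rewrite mulVf // gt_eqF.
have := chebS_conic t n; move: (chebS K n.+1).[t] (chebS K n).[t] => r s conic.
have sD : s ^+ 2 <= D.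
  have : (1 - t ^+ 2 / 4) * s ^+ 2 <= 1.
    by have := sqr_ge0 (r - t * s / 2); lra.
  by move/(ler_wpM2l (ltW D0)); rewrite mulrA DE mul1r mulr1.
by rewrite ler_norml; apply/andP; split; nra.
Qed.

Lemma cvg_subseq (u : nat -> K) (f : nat -> nat) (a : K) :
  increasing_seq f -> u @ \oo --> a -> (u \o f) @ \oo --> a.
Proof.
move=> incrf ua A /ua[N _ NA].
have fge k : (k <= f k)%N.
  by elim: k => // k IHk; apply: leq_ltn_trans IHk _; have /increasing_seqP := incrf; apply.
by exists N => // k /= Nk; apply: NA => /=; apply: leq_trans Nk (fge k).
Qed.

Lemma bounded_seq_fun (u : nat -> K) (C : K) : (forall n, `|u n| <= C) -> bounded_fun u.
Proof.
by move=> uC; exists C; split=> [|r Cr n _]; [exact: num_real|exact: le_trans (uC n) (ltW Cr)].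
Qed.

Lemma bounded_subseq2 (u v : nat -> K) (C : K) :
  (forall n, `|u n| <= C) -> (forall n, `|v n| <= C) ->
  exists (f : nat -> nat) (a b : K),
    [/\ injective f, (u \o f) @ \oo --> a & (v \o f) @ \oo --> b].
Proof.
move=> uC vC; have [f incrf cvgu] := bolzano_weierstrass (bounded_seq_fun uC).
have [n|g incrg cvgv] := bolzano_weierstrass (@bounded_seq_fun (v \o f) C _).
  exact: vC.
exists (f \o g), (limn (u \o f)), (limn (v \o f \o g)); split=> //.
  exact: inj_comp (increasing_seq_injective incrf) (increasing_seq_injective incrg).
exact: cvg_subseq incrg cvgu.
Qed.

Lemma SL2_cvg (m : nat -> SL2 K) (L : SL2 K) :
  (fun k => SL2_mx (m k)) @ \oo --> SL2_mx L -> m @ \oo --> L.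
Proof.
move=> mL A [_ [[B oB <-] BL BA]].
by apply: (filterS BA); apply: mL; apply: open_nbhs_nbhs.
Qed.

(* The powers of an elliptic element stay in a compact set. *)
Lemma elliptic_accumulation M : `|SL2_tr M| < 2 -> infinite_order (to_PSL2 M) ->
  exists (f : nat -> nat) (L : PSL2 K),
    injective (fun k => to_PSL2 M ^+ (f k).+1)%g /\
    (fun k => to_PSL2 M ^+ (f k).+1)%g @ \oo --> L.
Proof.
move=> tM infM; pose S n := (chebS K n).[SL2_tr M].
have [||f [a [b [injf Sa Sb]]]] := @bounded_subseq2 (fun n => S n.+1) S (1 + (1 - SL2_tr M ^+ 2 / 4)^-1).
- by move=> n; apply: chebS_bounded.
- by move=> n; apply: chebS_bounded.
(* The conic equation passes to the limit (a, b) of the pairs of coefficients, so the limit matrix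
   lies in SL(2,K). *)
have detL : \det (a *: SL2_mx M - b *: 1%:M) = 1.
  have -> : \det (a *: SL2_mx M - b *: 1%:M) = a ^+ 2 - SL2_tr M * a * b + b ^+ 2.
    rewrite /SL2_tr; have [p [q [r [s [-> det1]]]]] := SL2_mx2 M.
    have -> : a ^+ 2 = a ^+ 2 * (p * s - q * r) by rewrite det1 mulr1.
    by rewrite !mx2_simp; ring.
  have cvg1 : (fun k => S (f k).+1 ^+ 2 - SL2_tr M * S (f k).+1 * S (f k) + S (f k) ^+ 2) @ \oo
      --> a ^+ 2 - SL2_tr M * a * b + b ^+ 2.
    apply: cvgD; first apply: cvgB.
    - by rewrite expr2; under eq_fun do rewrite expr2; apply: cvgM.
    - by apply: cvgM => //; apply: cvgM => //; exact: cvg_cst.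
    - by rewrite expr2; under eq_fun do rewrite expr2; apply: cvgM.
  have cvg2 : (fun k => S (f k).+1 ^+ 2 - SL2_tr M * S (f k).+1 * S (f k) + S (f k) ^+ 2) @ \oo
      --> (1 : K).
    by under eq_fun do rewrite chebS_conic; exact: cvg_cst.
  exact: (cvg_unique (@norm_hausdorff _ _) cvg1 cvg2).
exists f, (to_PSL2 (MkSL2 (introT eqP detL))); split.
  move=> j k /= /eqP.
  wlog jk : j k / (f j <= f k)%N => [wl|].
    by case: (leqP (f j) (f k)) => [|/ltnW] jk; [|rewrite eq_sym => /(wl _ _ jk)->]; [exact: wl|].
  move=> /eqP eqX; apply/injf/eqP; rewrite eqn_leq jk leqNgt; apply/negP => ltjk.
  have kj0 : (0 < f k - f j)%N by rewrite subn_gt0.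
  apply: (infM _ kj0); apply: (mulgI (to_PSL2 M ^+ (f j).+1)%g).
  by rewrite -expgnDr addSn subnKC // mulg1.
under eq_fun do rewrite -to_PSL2X.
apply: (continuous_cvg _ (@pi_continuous _ _ _)); apply: SL2_cvg.
under eq_fun do rewrite SL2_mxX.
by apply: cvgB; apply: cvgZr_tmp.
Qed.

Lemma discrete_tr_ge2 G M :
    is_subgroup G -> discrete G -> (forall g m, G g -> (0 < m)%N -> (g ^+ m = 1 -> g = 1)%g) ->
  G (to_PSL2 M) -> 2 <= `|SL2_tr M|.
Proof.
move=> subG discG torG GM; rewrite leNgt; apply/negP => tM.
have infM : infinite_order (to_PSL2 M).
  move=> m m0 /(torG _ _ GM m0) /to_PSL2_eq1[] M1; move: tM; rewrite M1 ?SL2_trN ?normrN;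
    by rewrite /SL2_tr SL2_mx1 mxtrace1 ger0_norm // ltxx.
have [f [L [injf cvgf]]] := elliptic_accumulation tM infM.
apply: discG; exists (fun k => to_PSL2 M ^+ (f k).+1)%g, L; split=> // k.
exact: is_subgroupX.
Qed.

End Fuchsian.

(** * Ping-pong on the projective line *)

Section PingPong.
Variable K : realType.
Local Notation letter := ('I_2 * bool)%type.
Implicit Types (M N : SL2 K) (g h : PSL2 K) (C : letter -> 'M[K]_2) (l : letter) (w : seq letter).

(** Matrices act on row vectors from the right, so a word acts letter by letter from its first
    letter. The value is the same at v and -v, hence does not see the choice of lifts from
    PSL(2,K). *)
Definition qf (A : 'M[K]_2) (v : 'rV[K]_2) : K := (v *m A *m v^T) 0 0.

(* The cones [qf (C l) > 0] are four disjoint arcs of the projective line, and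
   the matrix [a l] maps the exterior of the arc of [l^-1] into the arc of [l]. *)
Definition pingpong (a : letter -> 'M[K]_2) C :=
  [/\ forall l l' v, l != l' -> 0 < qf (C l) v -> qf (C l') v < 0,
      forall l v, qf (C (letter_inv l)) v < 0 -> 0 < qf (C l) (v *m a l)
    & forall l, exists v, 0 < qf (C l) v].

Definition pair_gen (T : Type) (g h : T) (i : 'I_2) : T := if i == 0 then g else h.

Lemma range_pair_gen (T : Type) (g h : T) : range (pair_gen g h) = [set g; h].
Proof.
apply/seteqP; split=> [_ [i _ <-]|_ []->]; rewrite /pair_gen.
- by case: eqP; [left|right].
- by exists 0.
- by exists 1.
Qed.

Lemma word_eval_to_PSL2 M N w :
  to_PSL2 (word_eval (pair_gen M N) w) =
  word_eval (pair_gen (to_PSL2 M) (to_PSL2 N)) w.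
Proof.
elim: w => [|[i b] w IHw]; first by rewrite !word_eval_nil.
rewrite !word_eval_cons to_PSL2M IHw; congr (_ * _)%g.
by rewrite /letter_eval /pair_gen /=; case: b; case: eqP => //; rewrite to_PSL2V.
Qed.

Lemma letter_avoid l l' : exists m : letter, m != l /\ m != l'.
Proof.
case: l => i b; have [e|n] := eqVneq l' (i, ~~ b); last first.
  by exists (i, ~~ b); split; [exact: letter_inv_neq (i, b)|rewrite eq_sym].
by rewrite e; case: (ord2P i) => ->; [exists (1, true)|exists (0, true)]; rewrite !xpair_eqE.
Qed.

Section Words.
Variables (u : 'I_2 -> SL2 K) (C : letter -> 'M[K]_2).
Hypothesis pp : pingpong (fun l => SL2_mx (letter_eval u l)) C.

(** After a letter the point lies in the arc of that letter. In a reduced word this is not the arc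
    of the inverse of the next letter, so the next push applies. *)
Lemma pingpong_last l w (v : 'rV[K]_2) :
  reduced_word (l :: w) -> qf (C (letter_inv l)) v < 0 ->
  0 < qf (C (last l w)) (v *m SL2_mx (word_eval u (l :: w))).
Proof.
have [disj push _] := pp.
elim: w l v => [|l' w IHw] l v.
  by rewrite word_eval_cons word_eval_nil mulg1 => _ /push.
rewrite reduced_cons => /andP[ll' redw] /push vl.
rewrite word_eval_cons SL2_mxM mulmxA; apply: IHw => //.
by apply: disj vl; apply: contraNneq ll' => ->; rewrite letter_invK.
Qed.

(** There are four letters, so some arc belongs neither to the inverse of the first letter nor to
    the last letter. A point starting there is carried into the arc of the last letter, hence out of
    its own. *)
Lemma pingpong_witness (xi : letter -> 'rV[K]_2) w :
  (forall l, 0 < qf (C l) (xi l)) -> reduced_word w -> w != [::] ->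
  exists l, qf (C l) (xi l *m SL2_mx (word_eval u w)) < 0.
Proof.
case: w => // l w xiC redw _; have [m [ml ml']] := letter_avoid (letter_inv l) (last l w).
have [disj _ _] := pp.
exists m; apply: (disj (last l w)); first by rewrite eq_sym.
by apply: pingpong_last => //; apply: disj (xiC m).
Qed.
End Words.

Lemma qfN A v : qf A (- v) = qf A v.
Proof. by rewrite /qf linearN /= !mulNmx mulmxN opprK. Qed.

Lemma qf_mulmx A v (B : 'M[K]_2) : qf A (v *m B) = qf (B *m A *m B^T) v.
Proof. by rewrite /qf trmx_mul !mulmxA. Qed.

Lemma qfE A (v : 'rV[K]_2) :
  qf A v = v 0 0 * v 0 0 * A 0 0 + v 0 0 * v 0 1 * (A 0 1 + A 1 0) + v 0 1 * v 0 1 * A 1 1.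
Proof. by rewrite /qf [A]mx2E !mxE !sum2 !mxE !sum2 !mxE /=; ring. Qed.

Lemma SL2_coord_continuous i j : continuous (fun M => SL2_mx M i j).
Proof.
move=> M; apply: (@continuous_comp _ _ _ (@SL2_mx K) (fun A : 'M[K]_2 => A i j)).
  exact: initial_continuous.
exact: coord_continuous.
Qed.

Lemma repr_even_continuous (f : SL2 K -> K) :
  continuous f -> (forall M, f (SL2_opp M) = f M) -> continuous (fun g => f (repr g)).
Proof.
move=> cf fN; apply: (repr_comp_continuous cf) => M N /eqP /to_PSL2_eq [->//|->].
by rewrite fN.
Qed.

(** The quotients of consecutive terms tend to 1. As [repr] is not continuous, the value is expanded
    into products of functions that are even in each lift, and these descend to PSL(2,K). *)
Lemma qf_repr_cvg A (xi : 'rV[K]_2) (u : nat -> PSL2 K) g :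
  u @ \oo --> g ->
  qf A (xi *m SL2_mx ((repr (u n))^-1 * repr (u n.+1))%g) @[n --> \oo] --> qf A xi.
Proof.
move=> ug.
(* [X] collects the entries of M A M^T, for the later term, and [Y] the products of two coordinates
   of xi M^-1, for the earlier one; both are even in M. *)
pose X i j M := (SL2_mx M *m A *m (SL2_mx M)^T) i j.
pose Y i j M := (xi *m SL2_mx M^-1%g) 0 i * (xi *m SL2_mx M^-1%g) 0 j.
have XN i j M : X i j (SL2_opp M) = X i j M.
  by rewrite /X SL2_mxN linearN /= !mulNmx mulmxN opprK.
have YN i j M : Y i j (SL2_opp M) = Y i j M.
  rewrite /Y SL2_invN SL2_mxN mulmxN !mxE; ring.
have cC := SL2_coord_continuous.
have cK (c : K) : continuous (fun _ : SL2 K => c) by exact: cst_continuous.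
have cD (f h : SL2 K -> K) : continuous f -> continuous h -> continuous (fun M => f M + h M).
  by move=> cf ch M; exact: (cvgD (cf M) (ch M)).
have cB (f h : SL2 K -> K) : continuous f -> continuous h -> continuous (fun M => f M - h M).
  by move=> cf ch M; exact: (cvgB (cf M) (ch M)).
have cM (f h : SL2 K -> K) : continuous f -> continuous h -> continuous (fun M => f M * h M).
  by move=> cf ch M; exact: (cvgM (cf M) (ch M)).
have cX i j : continuous (X i j).
  have -> : X i j = fun M =>
      (SL2_mx M i 0 * A 0 0 + SL2_mx M i 1 * A 1 0) * SL2_mx M j 0 +
      (SL2_mx M i 0 * A 0 1 + SL2_mx M i 1 * A 1 1) * SL2_mx M j 1.
    by apply/funext => M; rewrite /X !mxE sum2 !mxE !sum2.
  exact: (cD _ _ (cM _ _ (cD _ _ (cM _ _ (cC i 0) (cK _)) (cM _ _ (cC i 1) (cK _))) (cC j 0))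
                 (cM _ _ (cD _ _ (cM _ _ (cC i 0) (cK _)) (cM _ _ (cC i 1) (cK _))) (cC j 1))).
have cV i : continuous (fun M => (xi *m SL2_mx M^-1%g) 0 i).
  have VE M : xi *m SL2_mx M^-1%g =
      rv2 (xi 0 0 * SL2_mx M 1 1 - xi 0 1 * SL2_mx M 1 0)
          (xi 0 1 * SL2_mx M 0 0 - xi 0 0 * SL2_mx M 0 1).
    rewrite SL2_mxV [in LHS](rv2E xi) [in LHS](mx2E (SL2_mx M)) mx2_inv.
      by rewrite mulrv2; congr rv2; ring.
    by rewrite -det_mx2 -mx2E SL2_detE.
  have [->|->] := ord2P i.
    have -> : (fun M => (xi *m SL2_mx M^-1%g) 0 0) =
              fun M => xi 0 0 * SL2_mx M 1 1 - xi 0 1 * SL2_mx M 1 0.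
      by apply/funext => N; rewrite VE !mxE.
    exact: (cB _ _ (cM _ _ (cK _) (cC 1 1)) (cM _ _ (cK _) (cC 1 0))).
  have -> : (fun M => (xi *m SL2_mx M^-1%g) 0 1) =
            fun M => xi 0 1 * SL2_mx M 0 0 - xi 0 0 * SL2_mx M 0 1.
    by apply/funext => N; rewrite VE !mxE.
  exact: (cB _ _ (cM _ _ (cK _) (cC 0 0)) (cM _ _ (cK _) (cC 0 1))).
have cY i j : continuous (Y i j) by exact: (cM _ _ (cV i) (cV j)).
have FE M N : qf A (xi *m SL2_mx (M^-1 * N)%g) =
    Y 0 0 M * X 0 0 N + Y 0 1 M * (X 0 1 N + X 1 0 N) + Y 1 1 M * X 1 1 N.
  by rewrite SL2_mxM mulmxA qf_mulmx qfE /X /Y.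
have -> : qf A xi = qf A (xi *m SL2_mx ((repr g)^-1 * repr g)%g).
  by rewrite mulVg SL2_mx1 mulmx1.
rewrite FE; under eq_fun do rewrite FE.
have ug1 : (fun n => u n.+1) @ \oo --> g by move=> B /ug[N _ NB]; exists N => // k /= Nk; apply: NB; exact: leqW.
have cvY i j : Y i j (repr (u n)) @[n --> \oo] --> Y i j (repr g).
  exact: (@cvg_comp _ _ _ u (fun h => Y i j (repr h)) _ _ _ ug (@repr_even_continuous _ (cY i j) (YN i j) g)).
have cvX i j : X i j (repr (u n.+1)) @[n --> \oo] --> X i j (repr g).
  exact: (@cvg_comp _ _ _ _ (fun h => X i j (repr h)) _ _ _ ug1 (@repr_even_continuous _ (cX i j) (XN i j) g)).
exact: (cvgD (cvgD (cvgM (cvY 0 0) (cvX 0 0)) (cvgM (cvY 0 1) (cvgD (cvX 0 1) (cvX 1 0))))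
             (cvgM (cvY 1 1) (cvX 1 1))).
Qed.

Lemma pingpong_free_fuchsian M N C :
    pingpong (fun l => SL2_mx (letter_eval (pair_gen M N) l)) C ->
    SL2_tr (M * N * M^-1 * N^-1)%g != 2 ->
  free_fuchsian 2 (gen [set to_PSL2 M; to_PSL2 N]).
Proof.
move=> pp tr2; have [_ _ /choice[xi xiC]] := pp.
have wit := pingpong_witness pp xiC.
pose v := pair_gen (to_PSL2 M) (to_PSL2 N).
have free_v w : reduced_word w -> word_eval v w = 1%g -> w = [::].
  move=> redw; rewrite -word_eval_to_PSL2 => /to_PSL2_eq1 w1.
  apply/eqP/negP => /negP /(wit _ redw) [l].
  suff -> : qf (C l) (xi l *m SL2_mx (word_eval (pair_gen M N) w)) = qf (C l) (xi l).
    by rewrite ltNge (ltW (xiC l)).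
  by case: w1 => ->; rewrite ?SL2_mxN SL2_mx1 ?mulmxN mulmx1 ?qfN.
have genE : gen [set to_PSL2 M; to_PSL2 N] = gen (range v) by rewrite range_pair_gen.
have inf i : infinite_order (v i).
  move=> m m0 vm.
  have red_nseq k : reduced_word (nseq k (i, false)).
    case: k => //= k; elim: k => //= k ->; by rewrite andbT xpair_eqE andbF.
  have : nseq m (i, false) = [::].
    apply: (free_v _ (red_nseq m)); rewrite -vm.
    elim: m {m0 vm} => [|m IHm]; first by rewrite word_eval_nil.
    by rewrite /= word_eval_cons IHm expgS.
  by case: m m0 {vm}.
split; last by exists v.
split; first exact: gen_subgroup.
  case=> u [g [Gu inju ug]].
  (* For large n the quotient of consecutive terms keeps each of the four base points in its own
     arc. It is nontrivial by injectivity, so a reduced word for it contradicts [wit]. *)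
  have /filter_ex[n un] : \forall n \near \oo, forall l,
      0 < qf (C l) (xi l *m SL2_mx ((repr (u n))^-1 * repr (u n.+1))%g).
    apply: filter_forall => l.
    by apply: (@cvgr_gt _ _ _ _ _ (qf (C l) (xi l))); [apply: qf_repr_cvg; exact: ug|exact: xiC].
  have Gn : gen (range v) ((u n)^-1 * u n.+1)%g.
    rewrite -genE; have [_ GM GV] := gen_subgroup [set to_PSL2 M; to_PSL2 N].
    by apply: GM; [apply: GV|]; exact: Gu.
  have [w0 w0E] := gen_range_word Gn.
  have [w redw wE] := reduced_form v w0.
  have w_neq0 : w != [::].
    apply/eqP => w1; have /inju : u n = u n.+1.
      apply: (mulgI (u n)^-1%g); rewrite w0E -wE w1 word_eval_nil mulVg //.
    by move/eqP; rewrite -[X in X == _]addn0 -addn1 eqn_add2l.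
  have [l] := wit _ redw w_neq0; apply/negP; rewrite -leNgt ltW //.
  suff <- : qf (C l) (xi l *m SL2_mx ((repr (u n))^-1 * repr (u n.+1))%g) =
            qf (C l) (xi l *m SL2_mx (word_eval (pair_gen M N) w)) by [].
  have /to_PSL2_eq[->//|->] : to_PSL2 ((repr (u n))^-1 * repr (u n.+1))%g =
      to_PSL2 (word_eval (pair_gen M N) w).
    by rewrite word_eval_to_PSL2 -/v wE -w0E to_PSL2M to_PSL2V !reprPSL2K.
  by rewrite SL2_mxN mulmxN qfN.
move=> elem; move/eqP: tr2; apply; rewrite -comm_trE; apply: elem.
- by apply: sub_gen; left.
- by apply: sub_gen; right.
- exact: (inf 0).
- exact: (inf 1).
Qed.

Lemma pingpong_conj (a : letter -> 'M[K]_2) C (P : 'M[K]_2) : P \in unitmx ->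
  pingpong (fun l => P *m a l *m invmx P) C ->
  pingpong a (fun l => invmx P *m C l *m (invmx P)^T).
Proof.
move=> uP [disj push pts]; split=> [l l' v|l v|l].
- by rewrite -!qf_mulmx; exact: disj.
- by rewrite -!qf_mulmx => /push; rewrite !mulmxA mulmxKV.
- by have [v vl] := pts l; exists (v *m P); rewrite -qf_mulmx mulmxK.
Qed.

End PingPong.

(** * Arcs for a one-holed torus *)

Section Arcs.
Variable K : realType.
Local Notation letter := ('I_2 * bool)%type.
Implicit Types (x y p : K).

Definition letter_case (T : Type) (s s' t t' : T) (l : letter) : T :=
  if l.1 == 0 then if l.2 then s' else s else if l.2 then t' else t.

Lemma letterP (P : letter -> Prop) :
  P (0, false) -> P (0, true) -> P (1, false) -> P (1, true) -> forall l, P l.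
Proof. by move=> ? ? ? ? [i []]; case: (ord2P i) => ->. Qed.

(** Represents a product of two linear forms, whose zero lines are the end points of an arc. It need
    not be symmetric, since [qf] sees only the symmetric part. *)
Definition prod_mx (p q p' q' : K) : 'M[K]_2 := mx2 (p * p') (p * q') (q * p') (q * q').

Lemma qf_prod_mx (p q p' q' : K) (v : 'rV[K]_2) :
  qf (prod_mx p q p' q') v = (p * v 0 0 + q * v 0 1) * (p' * v 0 0 + q' * v 0 1).
Proof. by rewrite qfE !mxE /=; ring. Qed.

Lemma mul_lt0_le x y : y <= x -> x * y < 0 -> 0 < x /\ y < 0.
Proof.
move=> yx xy0; split; rewrite ltNge; apply/negP => h; move: xy0; apply/negP; rewrite -leNgt.
  by apply: mulr_le0; [|exact: le_trans h].
by apply: mulr_ge0; [exact: le_trans yx|].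
Qed.

Lemma mul_gt0_cases x y : 0 < x * y -> (0 < x /\ 0 < y) \/ (x < 0 /\ y < 0).
Proof.
have [x0|x0|->] := ltgtP x 0; last by rewrite mul0r ltxx.
  by rewrite nmulr_rgt0 //; right.
by rewrite pmulr_rgt0 //; left.
Qed.

(** * Disjointness of arcs with ordered end points *)

Section MonotoneFactors.
Variables g1 g2 g3 g4 : K.
Hypotheses (g21 : g2 <= g1) (g32 : g3 <= g2) (g43 : g4 <= g3).

(** The [g]s stand for the four values x - p_i y at one point; their order reduces the position of
    the point relative to two arcs to a sign argument. *)
Lemma mono_inner : g2 * g3 < 0 -> g1 * g4 < 0.
Proof.
by move=> /(mul_lt0_le g32)[h2 h3]; rewrite pmulr_rlt0; [exact: le_lt_trans h3|exact: lt_le_trans g21].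
Qed.

Lemma mono_outer : 0 < g1 * g4 -> 0 < g2 * g3.
Proof.
have g42 := le_trans g43 g32; have g31 := le_trans g32 g21.
case/mul_gt0_cases=> -[h1 h4]; [apply: mulr_gt0|rewrite -mulrNN; apply: mulr_gt0; rewrite oppr_gt0].
- exact: lt_le_trans g42.
- exact: lt_le_trans g43.
- exact: le_lt_trans h1.
- exact: le_lt_trans h1.
Qed.

Lemma mono_left : g1 * g2 < 0 -> 0 < g3 * g4.
Proof.
move=> /(mul_lt0_le g21)[_ h2]; have h3 := le_lt_trans g32 h2.
by rewrite nmulr_rgt0 //; exact: le_lt_trans h3.
Qed.

Lemma mono_right : g3 * g4 < 0 -> 0 < g1 * g2.
Proof.
move=> /(mul_lt0_le g43)[h3 _]; have h2 := lt_le_trans h3 g32.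
by rewrite pmulr_rgt0 //; exact: lt_le_trans g21.
Qed.

End MonotoneFactors.

Section OrderedPoints.
Variables p1 p2 p3 p4 : K.
Hypotheses (p12 : p1 <= p2) (p23 : p2 <= p3) (p34 : p3 <= p4).

Let lin_mono (p p' x y : K) : p <= p' ->
  (0 <= y -> x - p' * y <= x - p * y) /\ (y <= 0 -> x - p * y <= x - p' * y).
Proof. by move=> pp'; split=> y0; rewrite lerD2l lerN2; [exact: ler_wpM2r|exact: ler_wnM2r]. Qed.

(** For y <= 0 the four factors come in the reverse order, which exchanges the left and the right
    pair. *)
Ltac by_orientation y lr rl :=
  let h := fresh in let y0 := fresh in
  move=> h; have [y0|/ltW y0] := leP 0 y;
  [apply: lr h|rewrite mulrC in h; rewrite mulrC; apply: rl h];
  by [apply: (proj1 (lin_mono _ _ p12))|apply: (proj1 (lin_mono _ _ p23))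
     |apply: (proj1 (lin_mono _ _ p34))|apply: (proj2 (lin_mono _ _ p12))
     |apply: (proj2 (lin_mono _ _ p23))|apply: (proj2 (lin_mono _ _ p34))].

Lemma arc_inner x y :
  (x - p2 * y) * (x - p3 * y) < 0 -> (x - p1 * y) * (x - p4 * y) < 0.
Proof. by_orientation y mono_inner mono_inner. Qed.

Lemma arc_outer x y :
  0 < (x - p1 * y) * (x - p4 * y) -> 0 < (x - p2 * y) * (x - p3 * y).
Proof. by_orientation y mono_outer mono_outer. Qed.

Lemma arc_left x y :
  (x - p1 * y) * (x - p2 * y) < 0 -> 0 < (x - p3 * y) * (x - p4 * y).
Proof. by_orientation y mono_left mono_right. Qed.

Lemma arc_right x y :
  (x - p3 * y) * (x - p4 * y) < 0 -> 0 < (x - p1 * y) * (x - p2 * y).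
Proof. by_orientation y mono_right mono_left. Qed.

End OrderedPoints.

(** For p < p', the sign s = -1 selects the bounded arc between p and p', and s = 1 the
    complementary arc through infinity. *)
Definition arc_mx (s p p' : K) : 'M[K]_2 := prod_mx s (- (s * p)) 1 (- p').

Lemma qf_arc_mx (s p p' : K) (v : 'rV[K]_2) :
  qf (arc_mx s p p') v = s * ((v 0 0 - p * v 0 1) * (v 0 0 - p' * v 0 1)).
Proof. by rewrite qf_prod_mx; ring. Qed.

Lemma mul_rv2_mx2 (v : 'rV[K]_2) (a b c d : K) :
  v *m mx2 a b c d = rv2 (v 0 0 * a + v 0 1 * c) (v 0 0 * b + v 0 1 * d).
Proof. by rewrite {1}[v]rv2E mulrv2. Qed.

Lemma posD_comb (c1 c2 g1 g2 : K) :
  0 <= c1 -> 0 <= c2 -> 0 < c1 + c2 -> 0 < g1 -> 0 < g2 -> 0 < c1 * g1 + c2 * g2.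
Proof.
move=> c1_ge0 c2_ge0 c12 g1_gt0 g2_gt0.
have [c1_gt0|c1_le0] := ltP 0 c1; first by rewrite ltr_wpDr ?mulr_ge0 ?mulr_gt0 // ltW.
have -> : c1 = 0 by apply: le_anti; rewrite c1_le0.
by rewrite mul0r add0r mulr_gt0 //; lra.
Qed.

(** Up to the factor L - 1, the linear forms [E1] and [E2] giving the position of the image are
    combinations of the two forms giving the position of the point. The two inequalities on m say
    that the coefficients are nonnegative, so the signs carry over. *)
Lemma torus_push (a b d m L x y : K) :
    1 < L -> 0 < m -> 0 < a -> 0 < d -> m ^+ 2 * b * L = a * d ->
    2 * m * L <= L + 1 -> 2 <= m * (L + 1) -> 
    0 < (x - - (m / a * L) * y) * (x - - (m / a) * y) ->
  (x * a + y - m / d * (x * b + y * d)) * (x * a + y - m / d * L * (x * b + y * d)) < 0.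
Proof.
move=> L1 m0 a0 d0 mbL mL mL2; set y' := m / a * y.
have -> : x - - (m / a * L) * y = x + L * y' by rewrite /y'; ring.
have -> : x - - (m / a) * y = x + y' by rewrite /y'; ring.
have L0 : 0 < L by lra.
have [a_n0 d_n0 m_n0 L_n0] : [/\ a != 0, d != 0, m != 0 & L != 0].
  by split; apply: lt0r_neq0.
have bE : b = a * d / (m ^+ 2 * L).
  by rewrite -mbL; field; rewrite m_n0 L_n0.
pose E1 := (m * L - 1) * x + (1 - m) * L * y'.
pose E2 := (1 - m) * x + (m * L - 1) * y'.
have -> : x * a + y - m / d * (x * b + y * d) = a / (m * L) * E1.
  by rewrite bE /E1 /y'; field; rewrite a_n0 d_n0 m_n0 L_n0.
have -> : x * a + y - m / d * L * (x * b + y * d) = - (a / m * E2).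
  by rewrite bE /E2 /y'; field; rewrite a_n0 d_n0 m_n0 L_n0.
move=> g_gt0; rewrite mulrN oppr_lt0 mulrACA pmulr_rgt0; last first.
  by rewrite mulr_gt0 // divr_gt0 // mulr_gt0.
have mL_gt1 : 1 < m * L by nra.
have m_lt1 : m < 1 by nra.
have E1E : (L - 1) * E1 =
    (L + 1 - 2 * m * L) * (x + L * y') + L * (m * (L + 1) - 2) * (x + y').
  by rewrite /E1; ring.
have E2E : (L - 1) * E2 =
    (m * (L + 1) - 2) * (x + L * y') + (L + 1 - 2 * m * L) * (x + y').
  by rewrite /E2; ring.
suff : 0 < (L - 1) * E1 * ((L - 1) * E2).
  by rewrite mulrACA pmulr_rgt0 // mulr_gt0 // subr_gt0.
rewrite E1E E2E.
have c1 : 0 <= L + 1 - 2 * m * L by lra.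
have c2 : 0 <= m * (L + 1) - 2 by lra.
have c2' : 0 <= L * (m * (L + 1) - 2) by apply: mulr_ge0 => //; exact: ltW.
have c12 : 0 < L + 1 - 2 * m * L + L * (m * (L + 1) - 2).
  have -> : L + 1 - 2 * m * L + L * (m * (L + 1) - 2) = (m * L - 1) * (L - 1) by ring.
  by apply: mulr_gt0; lra.
have c21 : 0 < m * (L + 1) - 2 + (L + 1 - 2 * m * L).
  have -> : m * (L + 1) - 2 + (L + 1 - 2 * m * L) = (1 - m) * (L - 1) by ring.
  by apply: mulr_gt0; lra.
move: c1 c2 c2' c12 c21 g_gt0.
move: (L * (m * (L + 1) - 2)) (m * (L + 1) - 2) (L + 1 - 2 * m * L) (x + L * y') (x + y').
move=> k1 k2 k3 g1 g2 c1 c2 c2' c12 c21.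
case/mul_gt0_cases=> -[h1 h2]; first by apply: mulr_gt0; apply: posD_comb.
by rewrite -[X in 0 < X]mulrNN; apply: mulr_gt0; rewrite opprD -!mulrN;
  apply: posD_comb; rewrite ?oppr_gt0.
Qed.

(** Around the circle the arcs of the two generators alternate: those of a letter and of its inverse
    are opposite, as for a one-holed torus. *)
Definition four_arcs (p1 p2 p3 p4 : K) : letter -> 'M[K]_2 :=
  letter_case (arc_mx 1 p1 p4) (arc_mx (-1) p2 p3) (arc_mx (-1) p3 p4) (arc_mx (-1) p1 p2).

Lemma four_arcs_disjoint p1 p2 p3 p4 l l' v : p1 <= p2 -> p2 <= p3 -> p3 <= p4 -> l != l' ->
  0 < qf (four_arcs p1 p2 p3 p4 l) v -> qf (four_arcs p1 p2 p3 p4 l') v < 0.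
Proof.
move=> p12 p23 p34; have p13 := le_trans p12 p23; have p24 := le_trans p23 p34.
move: l l'; apply: letterP; apply: letterP => //= _; rewrite /four_arcs /letter_case /=;
  rewrite !qf_arc_mx ?mul1r ?mulN1r ?oppr_gt0 ?oppr_lt0;
  move: (v 0 0) (v 0 1) => x y.
- exact: arc_outer.
- exact: arc_outer.
- exact: arc_outer.
- exact: arc_inner.
- exact: arc_left.
- exact: arc_right.
- exact: arc_inner.
- exact: arc_right.
- exact: arc_right.
- exact: arc_inner.
- exact: arc_left.
- exact: arc_left.
Qed.

(* The arcs are separated by -m L / a < -m / a < m / d < m L / d with L = l^2: the
   diagonal matrix maps the inner pair of points to the outer pair, and m^2 =
   a d / (b L) is chosen so that the condition for the other matrix becomes
   4 L <= b (L - 1)^2, that is, commutator trace <= -2. *)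
Lemma pingpong_torus (l a b d : K) :
    1 < l -> 0 < a -> 0 < d -> 0 < b -> a * d - b = 1 ->
    4 * l ^+ 2 <= b * (l ^+ 2 - 1) ^+ 2 ->
  exists C, pingpong (letter_case (mx2 l 0 0 l^-1) (mx2 l^-1 0 0 l)
                                  (mx2 a b 1 d) (mx2 d (- b) (-1) a)) C.
Proof.
move=> l1 a0 d0 b0 det1 hb; set L := l ^+ 2 in hb.
have l0 : 0 < l by lra.
have l_n0 : l != 0 by apply: lt0r_neq0.
have L1 : 1 < L by rewrite /L; nra.
have L0 : 0 < L by lra.
pose m := Num.sqrt (a * d / (b * L)).
have q0 : 0 < a * d / (b * L) by rewrite divr_gt0 ?mulr_gt0.
have m0 : 0 < m by rewrite sqrtr_gt0.
have mbL : m ^+ 2 * b * L = a * d.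
  by rewrite sqr_sqrtr ?(ltW q0) //; field; rewrite !lt0r_neq0.
(* After squaring and using m^2 b L = ad = 1 + b, this is 4 L (1 + b) <= b (L + 1)^2, that is, the
   hypothesis 4 L <= b (L - 1)^2. *)
have mL : 2 * m * L <= L + 1.
  rewrite -(@ler_pXn2r _ 2) ?nnegrE; [|by []|nra|lra].
  rewrite -(ler_pM2r b0).
  have -> : (2 * m * L) ^+ 2 * b = 4 * L * (m ^+ 2 * b * L) by ring.
  rewrite mbL; have -> : a * d = 1 + b by lra.
  by move: hb; rewrite !expr2; lra.
(* Here ad >= b gives m^2 L >= 1, and (L + 1)^2 >= 4 L. *)
have mL2 : 2 <= m * (L + 1).
  rewrite -(@ler_pXn2r _ 2) ?nnegrE; [|by []|lra|nra].
  have mL_ge1 : 1 <= m ^+ 2 * L.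
    rewrite -(ler_pM2r b0) mulrAC mbL; lra.
  have := sqr_ge0 (L - 1); have := sqr_ge0 m; rewrite exprMn; nra.
exists (four_arcs (- (m / a * L)) (- (m / a)) (m / d) (m / d * L)).
have ma0 : 0 < m / a by apply: divr_gt0.
have md0 : 0 < m / d by apply: divr_gt0.
have p12 : - (m / a * L) <= - (m / a) by rewrite lerN2 ler_peMr // ltW.
have p23 : - (m / a) <= m / d by lra.
have p34 : m / d <= m / d * L by rewrite ler_peMr // ltW.
split=> [l1' l2' v| |].
- exact: four_arcs_disjoint.
- apply: letterP => v; rewrite /four_arcs /letter_case /= !qf_arc_mx mul_rv2_mx2 !mxE /=;
    rewrite ?mul1r ?mulN1r ?oppr_gt0 ?oppr_lt0;
    move: (v 0 0) (v 0 1) => x y.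
  + move=> h; set e := (X in 0 < X).
    suff -> : e = L * ((x - - (m / a) * y) * (x - m / d * y)) by rewrite mulr_gt0.
    by rewrite /e /L; field; rewrite l_n0 !lt0r_neq0.
  + move=> h; set e := (X in X < 0).
    suff -> : e = L^-1 * ((x - - (m / a * L) * y) * (x - m / d * L * y)).
      by rewrite pmulr_rlt0 // invr_gt0.
    by rewrite /e /L; field; rewrite l_n0 !lt0r_neq0.
  + by rewrite mulr1; apply: torus_push.
  (* The inverse matrix is handled by the reflection y -> -y, which exchanges a and d. *)
  + move=> h; have mbL' : m ^+ 2 * b * L = d * a by rewrite mbL mulrC.
    have := @torus_push d b a m L x (- y) L1 m0 d0 a0 mbL' mL mL2.
    have -> : x - - (m / d * L) * - y = x - m / d * L * y by ring.
    have -> : x - - (m / d) * - y = x - m / d * y by ring.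
    rewrite [X in 0 < X -> _]mulrC => /(_ h); congr (_ < 0); ring.
- apply: letterP.
  + exists (rv2 1 0); rewrite qf_arc_mx !mxE /=; lra.
  + exists (rv2 0 1); rewrite qf_arc_mx !mxE /=; nra.
  + exists (rv2 (m / d * (1 + L) / 2) 1); rewrite qf_arc_mx !mxE /=.
    by have := mulr_gt0 md0 md0; nra.
  + exists (rv2 (- (m / a * (1 + L) / 2)) 1); rewrite qf_arc_mx !mxE /=.
    by have := mulr_gt0 ma0 ma0; nra.
Qed.

End Arcs.

(** * Arcs for a pair of pants *)

Section Pants.
Variable K : realType.
Local Notation letter := ('I_2 * bool)%type.

Section IdealArcs.
Variables u w : K.

(* The arcs separated by the points u < 0 < w and infinity. *)
Definition ideal_arcs : letter -> 'M[K]_2 :=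
  letter_case (prod_mx 1 (- w) 0 1) (prod_mx (-1) u 0 1)
              (prod_mx (-1) 0 1 (- u)) (prod_mx (-1) 0 1 (- w)).

Lemma qf_ideal_arcs (v : 'rV[K]_2) (x := v 0 0) (y := v 0 1) :
  [/\ qf (ideal_arcs (0, false)) v = (x - w * y) * y,
      qf (ideal_arcs (0, true)) v = - ((x - u * y) * y),
      qf (ideal_arcs (1, false)) v = - (x * (x - u * y))
    & qf (ideal_arcs (1, true)) v = - (x * (x - w * y))].
Proof. by rewrite /ideal_arcs /letter_case /= !qf_prod_mx -/x -/y; split; ring. Qed.

Lemma ideal_arcs_disjoint l l' v : u < 0 -> 0 < w -> l != l' ->
  0 < qf (ideal_arcs l) v -> qf (ideal_arcs l') v < 0.
Proof.
move=> u0 w0; have [qA qA' qB qB'] := qf_ideal_arcs v.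
move: l l'; apply: letterP; apply: letterP => //= _; rewrite ?qA ?qA' ?qB ?qB';
  rewrite ?oppr_gt0 ?oppr_lt0; move: (v 0 0) (v 0 1) => x y h;
  have x2 := sqr_ge0 x; have y2 := sqr_ge0 y.
- have : 0 <= (w - u) * y ^+ 2 by apply: mulr_ge0 => //; lra.
  lra.
- have xy : 0 < x * y by have := mulr_ge0 (ltW w0) y2; lra.
  have : u * (x * y) < 0 by rewrite nmulr_rlt0.
  lra.
- have : 0 < w * ((x - w * y) * y) by apply: mulr_gt0.
  have := sqr_ge0 (x - w * y); lra.
- have : 0 <= (w - u) * y ^+ 2 by apply: mulr_ge0 => //; lra.
  lra.
- have : 0 < u * ((x - u * y) * y) by rewrite nmulr_rgt0.
  have := sqr_ge0 (x - u * y); lra.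
- have xy : x * y < 0.
    have : u * y ^+ 2 <= 0 by apply: mulr_le0_ge0 => //; exact: ltW.
    lra.
  have : w * (x * y) < 0 by rewrite pmulr_rlt0.
  lra.
- have xy : x * y < 0 by rewrite -(nmulr_rgt0 _ u0); lra.
  have := mulr_ge0 (ltW w0) y2; lra.
- rewrite -(nmulr_rlt0 _ u0); have := sqr_ge0 (x - u * y); lra.
- have xy : x * y < 0 by rewrite -(nmulr_rgt0 _ u0); lra.
  have : w * (x * y) < 0 by rewrite pmulr_rlt0.
  lra.
- rewrite -(pmulr_rlt0 _ w0); have := sqr_ge0 (x - w * y); lra.
- have xy : 0 < x * y by rewrite -(pmulr_rgt0 _ w0); lra.
  have : u * y ^+ 2 <= 0 by apply: mulr_le0_ge0 => //; exact: ltW.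
  lra.
- have xy : 0 < x * y by rewrite -(pmulr_rgt0 _ w0); lra.
  have : u * (x * y) < 0 by rewrite nmulr_rlt0.
  lra.
Qed.

End IdealArcs.

(* With n = 1 + l m, u = - m / n and w = l / n, the first matrix fixes infinity and
   maps u to w, and the second one fixes 0 and maps w into the interval [u, 0]. *)
Lemma pingpong_pants (l m r : K) : 0 < l -> 0 < m -> l * m * r <= - (1 + l * m) ^+ 2 ->
  exists C, pingpong (letter_case (mx2 l 0 1 l^-1) (mx2 l^-1 0 (-1) l)
                                  (mx2 m r 0 m^-1) (mx2 m^-1 (- r) 0 m)) C.
Proof.
move=> l0 m0; set n := 1 + l * m => hr.
have n0 : 0 < n by have := mulr_gt0 l0 m0; rewrite /n; lra.
have [l_n0 m_n0 n_n0] : [/\ l != 0, m != 0 & n != 0] by split; apply: lt0r_neq0.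
have u0 : - (m / n) < 0 by rewrite oppr_lt0 divr_gt0.
have w0 : 0 < l / n by rewrite divr_gt0.
exists (ideal_arcs (- (m / n)) (l / n)); split=> [l1 l2 v| |].
- exact: ideal_arcs_disjoint.
- apply: letterP => v; have [qA qA' qB qB'] := qf_ideal_arcs (- (m / n)) (l / n) v;
    set v' := v *m _; have [qA1 qA1' qB1 qB1'] := qf_ideal_arcs (- (m / n)) (l / n) v';
    rewrite /letter_inv /= ?qA ?qA' ?qB ?qB' ?qA1 ?qA1' ?qB1 ?qB1';
    rewrite ?oppr_gt0 ?oppr_lt0 /v' /letter_case /= mul_rv2_mx2 !mxE /=;
    move: (v 0 0) (v 0 1) => x y h; have x2 := sqr_ge0 x.
  + set e := (X in 0 < X).
    suff -> : e = (x - - (m / n) * y) * y by [].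
    by rewrite /e /n; field; rewrite -/n ?l_n0 ?m_n0 ?n_n0.
  + set e := (X in X < 0).
    suff -> : e = (x - l / n * y) * y by [].
    by rewrite /e /n; field; rewrite -/n ?l_n0 ?m_n0 ?n_n0.
  + set e := (X in X < 0).
    have -> : e = m / n * (x * (m * (n + r) * x + y)).
      by rewrite /e /n; field; rewrite -/n ?l_n0 ?m_n0 ?n_n0.
    rewrite pmulr_rlt0; last by rewrite divr_gt0.
    (* The form at the image differs from a negative multiple of the form known to be positive by a
       multiple of x^2, whose coefficient is nonpositive exactly because n^2 + l m r <= 0. *)
    have h1 : 0 < n / l * (x * (x - l / n * y)) by rewrite mulr_gt0 // divr_gt0.
    have h2 : (n ^+ 2 + l * m * r) / l * x ^+ 2 <= 0.
      by apply: mulr_le0_ge0 => //; apply: mulr_le0_ge0; [lra|rewrite invr_ge0 ltW].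
    have -> : x * (m * (n + r) * x + y) =
        (n ^+ 2 + l * m * r) / l * x ^+ 2 - n / l * (x * (x - l / n * y)).
      by rewrite /n; field; rewrite -/n ?l_n0 ?m_n0 ?n_n0.
    lra.
  + set e := (X in X < 0).
    have -> : e = (m ^+ 2 * n)^-1 * (x * (n * x + l * m * r * x - l * m ^+ 2 * y)).
      by rewrite /e /n; field; rewrite -/n ?l_n0 ?m_n0 ?n_n0.
    rewrite pmulr_rlt0; last by rewrite invr_gt0 mulr_gt0 // exprn_gt0.
    have h1 : 0 < l * m * n * (x * (x - - (m / n) * y)).
      by apply: mulr_gt0 => //; rewrite !mulr_gt0.
    have h2 : (n ^+ 2 + l * m * r) * x ^+ 2 <= 0 by apply: mulr_le0_ge0 => //; lra.
    have -> : x * (n * x + l * m * r * x - l * m ^+ 2 * y) =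
        (n ^+ 2 + l * m * r) * x ^+ 2 - l * m * n * (x * (x - - (m / n) * y)).
      by rewrite /n; field; rewrite -/n ?l_n0 ?m_n0 ?n_n0.
    lra.
- apply: letterP.
  + exists (rv2 (l / n + 1) 1); have [-> _ _ _] := qf_ideal_arcs (- (m / n)) (l / n) (rv2 (l / n + 1) 1).
    by rewrite !mxE /=; lra.
  + exists (rv2 (- (m / n) - 1) 1); have [_ -> _ _] := qf_ideal_arcs (- (m / n)) (l / n) (rv2 (- (m / n) - 1) 1).
    by rewrite !mxE /=; lra.
  + exists (rv2 (- (m / n) / 2) 1); have [_ _ -> _] := qf_ideal_arcs (- (m / n)) (l / n) (rv2 (- (m / n) / 2) 1).
    by rewrite !mxE /=; nra.
  + exists (rv2 (l / n / 2) 1); have [_ _ _ ->] := qf_ideal_arcs (- (m / n)) (l / n) (rv2 (l / n / 2) 1).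
    by rewrite !mxE /=; nra.
Qed.

End Pants.

(** * Reduction to triangular form *)

Section Domains.
Variable K : realType.
Implicit Types (M N : SL2 K) (P : 'M[K]_2) (v w : 'rV[K]_2).

Lemma conj_adj M P a b c d : P \in unitmx -> a * d - b * c = 1 ->
  P *m SL2_mx M = mx2 a b c d *m P ->
  P *m SL2_mx M *m invmx P = mx2 a b c d /\
  P *m SL2_mx M^-1%g *m invmx P = mx2 d (- b) (- c) a.
Proof.
move=> uP det1 PM; have PMV : P *m SL2_mx M *m invmx P = mx2 a b c d by rewrite PM mulmxK.
split=> //; have uT : mx2 a b c d \in unitmx by rewrite unitmxE det_mx2 det1 unitr1.
apply: (can_inj (mulmxK uT)); rewrite -{1}PMV -mx2_inv // mulVmx //.
by rewrite !mulmxA mulmxKV // SL2_mxV mulmxKV ?SL2_unit // mulmxV.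
Qed.

Lemma pingpong_transport M N P a b c d e f g h :
    P \in unitmx -> a * d - b * c = 1 -> e * h - f * g = 1 ->
    P *m SL2_mx M = mx2 a b c d *m P -> P *m SL2_mx N = mx2 e f g h *m P ->
    (exists C, pingpong (letter_case (mx2 a b c d) (mx2 d (- b) (- c) a)
                                     (mx2 e f g h) (mx2 h (- f) (- g) e)) C) ->
  exists C, pingpong (fun l => SL2_mx (letter_eval (pair_gen M N) l)) C.
Proof.
move=> uP detM detN PM PN [C pp].
have [M1 M2] := conj_adj uP detM PM; have [N1 N2] := conj_adj uP detN PN.
eexists; apply: (pingpong_conj uP (C := C)).
suff -> : (fun l => P *m SL2_mx (letter_eval (pair_gen M N) l) *m invmx P) =
  letter_case (mx2 a b c d) (mx2 d (- b) (- c) a) (mx2 e f g h) (mx2 h (- f) (- g) e) by [].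
by apply/funext; apply: letterP; rewrite /letter_eval /letter_case /pair_gen /=.
Qed.

Lemma eigenrow M (l : K) : l ^+ 2 - SL2_tr M * l + 1 = 0 ->
  exists2 v : 'rV[K]_2, v != 0 & v *m SL2_mx M = l *: v.
Proof.
move=> root_l; have /eqP/det0P[v v0 vM] : \det (SL2_mx M - l%:M) = 0.
  rewrite -root_l /SL2_tr; have [a [b [c [d [-> det1]]]]] := SL2_mx2 M.
  have -> : 1 = a * d - b * c by [].
  by rewrite !mx2_simp; ring.
by exists v => //; apply/eqP; rewrite -subr_eq0 -mul_mx_scalar -mulmxBr vM.
Qed.

Lemma real_eigenvalue (x : K) : 2 <= x ->
  exists2 l, 1 <= l & l ^+ 2 - x * l + 1 = 0.
Proof.
move=> x2; have d0 : 0 <= x ^+ 2 - 4 by nra.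
exists ((x + Num.sqrt (x ^+ 2 - 4)) / 2).
  by have := sqrtr_ge0 (x ^+ 2 - 4); lra.
have := sqr_sqrtr d0; move: (Num.sqrt _) => s; rewrite !expr2 => s2.
by field: s2.
Qed.

Definition rows_mx v w : 'M[K]_2 := mx2 (v 0 0) (v 0 1) (w 0 0) (w 0 1).

Lemma rows_mxM v w P : rows_mx v w *m P = rows_mx (v *m P) (w *m P).
Proof. by rewrite /rows_mx [P]mx2E mulmx2 !mul_rv2_mx2 !mxE. Qed.

Lemma mx2_rows a b c d v w :
  mx2 a b c d *m rows_mx v w = rows_mx (a *: v + b *: w) (c *: v + d *: w).
Proof. by rewrite /rows_mx mulmx2 !mxE. Qed.

Lemma rv2_rows a b v w : rv2 a b *m rows_mx v w = a *: v + b *: w.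
Proof. by rewrite /rows_mx mulrv2 [RHS]rv2E !mxE. Qed.

Lemma mxtrace_conj P (X : 'M[K]_2) : P \in unitmx -> \tr (P *m X *m invmx P) = \tr X.
Proof. by move=> uP; rewrite mxtrace_mulC mulmxA mulVmx // mul1mx. Qed.

Lemma det_conj P (X : 'M[K]_2) : P \in unitmx -> \det (P *m X *m invmx P) = \det X.
Proof.
by move=> uP; rewrite !det_mulmx det_inv mulrAC divrr ?mul1r -?unitmxE.
Qed.

(** The commutator trace plus 2 equals x^2 + (y - xz/2)^2 + (1 - x^2/4) z^2, a sum of nonnegative
    terms when |x| <= 2. *)
Lemma trace_triple_eq0 (x y z : K) : comm_tr_of_triple (x, y, z) <= - 2 -> `|x| <= 2 ->
  [/\ x = 0, y = 0 & z = 0].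
Proof.
rewrite /comm_tr_of_triple ler_norml => comm_le /andP[x1 x2].
have sqr0 (t : K) : t ^+ 2 <= 0 -> t = 0.
  by move=> t2; apply/eqP; rewrite -sqrf_eq0; apply/eqP/le_anti; rewrite sqr_ge0 t2.
have x4 : x ^+ 2 <= 4 by nra.
have x0 : x = 0.
  apply: sqr0; have : 0 <= (1 - x ^+ 2 / 4) * z ^+ 2 by apply: mulr_ge0; [lra|exact: sqr_ge0].
  have := sqr_ge0 (y - x * z / 2); lra.
rewrite x0 in comm_le; split=> //; apply: sqr0.
  have := sqr_ge0 z; lra.
have := sqr_ge0 y; lra.
Qed.

(* Three zero traces would make [M] and [N] generate a quaternion group, which
   embeds in SU(2) but not in SL(2,R). *)
Lemma SL2_comm_le_tr M N : SL2_tr (M * N * M^-1 * N^-1)%g <= - 2 -> 2 < `|SL2_tr M|.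
Proof.
rewrite SL2_tr_comm => comm_le; rewrite ltNge; apply/negP.
move=> /(trace_triple_eq0 comm_le)[]; rewrite /SL2_tr SL2_mxM.
have [a [b [c [d [-> detM]]]]] := SL2_mx2 M; have [e [f [g [h [-> detN]]]]] := SL2_mx2 N.
rewrite !mx2_simp => x0 y0 z0.
have dE : d = - a by lra.
have hE : h = - e by lra.
move: z0 detM detN; rewrite dE hE => z0 detM detN.
have bc : b * c = - 1 - a ^+ 2 by lra.
have fg : f * g = - 1 - e ^+ 2 by lra.
have sq : (b * g + c * f) ^+ 2 = 4 * a ^+ 2 * e ^+ 2.
  have -> : b * g + c * f = - 2 * a * e by lra.
  ring.
(* This square would equal 4 a^2 e^2 - 4 (1 + a^2)(1 + e^2), which is negative. *)
have := sqr_ge0 (b * g - c * f).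
have -> : (b * g - c * f) ^+ 2 = (b * g + c * f) ^+ 2 - 4 * (b * c) * (f * g) by ring.
rewrite sq bc fg; have := sqr_ge0 a; have := sqr_ge0 e; lra.
Qed.

(* Conjugate [M] to a diagonal matrix, and rescale one eigenvector so that the
   lower left entry of the conjugate of [N] is 1. *)
Lemma torus_free_fuchsian M N :
  0 <= SL2_tr M -> 0 <= SL2_tr N -> SL2_tr (M * N * M^-1 * N^-1)%g <= - 2 ->
  free_fuchsian 2 (gen [set to_PSL2 M; to_PSL2 N]).
Proof.
move=> x0 y0 comm_le.
have comm2 : SL2_tr (M * N * M^-1 * N^-1)%g != 2.
  by apply/eqP => comm2; move: comm_le; rewrite comm2; lra.
have x2 : 2 < SL2_tr M by have := SL2_comm_le_tr comm_le; rewrite ger0_norm.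
have [l l_ge1 root_l] := real_eigenvalue (ltW x2).
have l1 : 1 < l.
  rewrite lt_neqAle l_ge1 andbT; apply/eqP => l1; move: root_l; rewrite -l1; lra.
have l0 : 0 < l by lra.
have l_n0 : l != 0 by apply: lt0r_neq0.
have xE : SL2_tr M = l + l^-1.
  by apply: (mulIf l_n0); rewrite mulrDl mulVf //; move: root_l; rewrite expr2; lra.
have [e1 e1_n0 e1M] := eigenrow root_l.
have [|e2 e2_n0 e2M] := @eigenrow M l^-1; first by rewrite xE; field.
have [[k kE]|uP0] := row2_dependent e2 e1_n0.
  have : (l - l^-1) *: e2 = 0 by rewrite scalerBl -e2M kE -scalemxAl e1M !scalerA mulrC subrr.
  move/eqP; rewrite scaler_eq0 (negbTE e2_n0) orbF subr_eq0 => /eqP lE.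
  by have := l1; have := mulfV l_n0; rewrite -lE; nra.
rewrite -/(rows_mx e1 e2) in uP0; set P0 := rows_mx e1 e2 in uP0.
have P0M : P0 *m SL2_mx M = mx2 l 0 0 l^-1 *m P0.
  by rewrite rows_mxM e1M e2M mx2_rows !scale0r addr0 add0r.
clearbody P0; pose N0 := P0 *m SL2_mx N *m invmx P0.
have P0N : P0 *m SL2_mx N = N0 *m P0 by rewrite mulmxKV.
have := mxtrace_conj (SL2_mx N) uP0; have := det_conj (SL2_mx N) uP0; rewrite -/N0 SL2_detE.
have trMN : SL2_tr (M * N)%g = \tr (mx2 l 0 0 l^-1 *m N0).
  rewrite /SL2_tr SL2_mxM -(mxtrace_conj _ uP0); congr (\tr _).
  by rewrite /N0 !mulmxA P0M.
move: comm_le y0; rewrite SL2_tr_comm /comm_tr_of_triple trMN xE /SL2_tr.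
move: P0N; rewrite (mx2E N0).
move: (N0 0 0) (N0 0 1) (N0 1 0) (N0 1 1) => a b c d P0N; rewrite !mx2_simp.
move=> comm_le y0 det1 trN; rewrite -trN in y0 comm_le.
(* In the diagonal basis of M the commutator trace is 2 - bc (l - 1/l)^2. *)
have hbc : 4 <= (b * c) * (l - l^-1) ^+ 2.
  have : (b * c) * (l - l^-1) ^+ 2 = 2 - ((l + l^-1) ^+ 2 + (a + d) ^+ 2 +
      (l * a + 0 * c + (0 * b + l^-1 * d)) ^+ 2 -
      (l + l^-1) * (a + d) * (l * a + 0 * c + (0 * b + l^-1 * d)) - 2).
    have -> : b * c = a * d - 1 by lra.
    by field.
  lra.
have bc0 : 0 < b * c.
  rewrite ltNge; apply/negP => bc_le0; have := sqr_ge0 (l - l^-1).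
  by move: hbc; move: (_ ^+ 2) => s hbc s0; have := mulr_le0_ge0 bc_le0 s0; lra.
have c_n0 : c != 0 by apply: contraTneq bc0 => ->; rewrite mulr0 ltxx.
have [a0 d0] : 0 < a /\ 0 < d.
  have ad0 : 0 < a * d by lra.
  by case: (mul_gt0_cases ad0) => // -[]; lra.
have [C pp] : exists C, pingpong (fun i => SL2_mx (letter_eval (pair_gen M N) i)) C.
  apply: (@pingpong_transport M N (mx2 c 0 0 1 *m P0) l 0 0 l^-1 a (b * c) 1 d).
  - by rewrite unitmx_mul uP0 andbT unitmxE det_mx2 unitfE mulr1 mul0r subr0.
  - by rewrite mulfV // mul0r subr0.
  - by rewrite mulr1; lra.
  - by rewrite -mulmxA P0M !mulmxA !mulmx2; congr (mx2 _ _ _ _ *m _); ring.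
  - by rewrite -mulmxA P0N !mulmxA !mulmx2; congr (mx2 _ _ _ _ *m _); ring.
  rewrite oppr0; apply: pingpong_torus => //.
  have -> : b * c * (l ^+ 2 - 1) ^+ 2 = b * c * (l - l^-1) ^+ 2 * l ^+ 2 by field.
  by rewrite ler_wpM2r // sqr_ge0.
exact: pingpong_free_fuchsian pp comm2.
Qed.

(* In a basis made of an eigenrow of [N] and the induced eigenrow of [M], both
   matrices become triangular. *)
Lemma pants_free_fuchsian M N :
  2 <= SL2_tr M -> 2 <= SL2_tr N -> SL2_tr (M * N)%g <= - 2 ->
  free_fuchsian 2 (gen [set to_PSL2 M; to_PSL2 N]).
Proof.
move=> x2 y2 z2.
have comm2 : SL2_tr (M * N * M^-1 * N^-1)%g != 2.
  rewrite SL2_tr_comm /comm_tr_of_triple; move: (SL2_tr M) (SL2_tr N) (SL2_tr (M * N)%g) x2 y2 z2.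
  move=> x y z x2 y2 z2; apply/eqP.
  have xy : 4 <= x * y by nra.
  have : 8 <= - (x * y * z) by move: (x * y) xy => p p4; nra.
  have := sqr_ge0 x; have := sqr_ge0 y; have : 4 <= z ^+ 2 by nra.
  lra.
have [l l1 root_l] := real_eigenvalue x2; have [m m1 root_m] := real_eigenvalue y2.
have [l0 m0] : 0 < l /\ 0 < m by split; lra.
have [l_n0 m_n0] : l != 0 /\ m != 0 by split; apply: lt0r_neq0.
have xE : SL2_tr M = l + l^-1.
  by apply: (mulIf l_n0); rewrite mulrDl mulVf //; move: root_l; rewrite expr2; lra.
have yE : SL2_tr N = m + m^-1.
  by apply: (mulIf m_n0); rewrite mulrDl mulVf //; move: root_m; rewrite expr2; lra.
have [|e2 e2_n0 e2N] := @eigenrow N m^-1; first by rewrite yE; field.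
have [[k e2M]|uQ] := row2_dependent (e2 *m SL2_mx M) e2_n0.
  by rewrite (common_eigenvector_comm_tr e2_n0 e2M e2N) eqxx in comm2.
rewrite -/(rows_mx e2 (e2 *m SL2_mx M)) in uQ.
(* By Cayley-Hamilton (M - l)(M - 1/l) = 0, so [e1] is an eigenrow for l. This also covers the
   parabolic case l = 1, where M becomes a Jordan block. *)
pose e1 := e2 *m SL2_mx M - l^-1 *: e2.
have e1M : e1 *m SL2_mx M = l *: e1.
  rewrite /e1 mulmxBl -mulmxA SL2_sqr mulmxBr -scalemxAr -scalemxAl mulmx1 xE.
  by rewrite scalerDl scalerBr scalerA mulfV // scale1r addrAC addrK.
pose P := rows_mx e1 e2.
have PE : P = mx2 (- l^-1) 1 1 0 *m rows_mx e2 (e2 *m SL2_mx M).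
  by rewrite mx2_rows !scale1r scale0r addr0 scaleNr addrC.
have uP : P \in unitmx.
  by rewrite PE unitmx_mul uQ andbT unitmxE det_mx2 unitfE mulr0 sub0r mulr1 oppr_eq0 oner_eq0.
have PM : P *m SL2_mx M = mx2 l 0 1 l^-1 *m P.
  by rewrite rows_mxM mx2_rows e1M scale0r addr0 scale1r /e1 subrK.
have e2P : rv2 0 1 *m P = e2 by rewrite rv2_rows scale0r add0r scale1r.
clearbody P; pose N0 := P *m SL2_mx N *m invmx P.
have PN : P *m SL2_mx N = N0 *m P by rewrite mulmxKV.
have := det_conj (SL2_mx N) uP; rewrite -/N0 SL2_detE.
have trMN : SL2_tr (M * N)%g = \tr (mx2 l 0 1 l^-1 *m N0).
  rewrite /SL2_tr SL2_mxM -(mxtrace_conj _ uP); congr (\tr _).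
  by rewrite /N0 !mulmxA PM.
have : rv2 0 1 *m N0 = m^-1 *: rv2 0 1.
  by rewrite /N0 !mulmxA e2P e2N -scalemxAl -e2P mulmxK.
move: PN; rewrite trMN (mx2E N0) in z2 *; move: z2.
move: (N0 0 0) (N0 0 1) (N0 1 0) (N0 1 1) => a b c d; rewrite mulrv2 scalerv2 !mx2_simp.
move=> z2 PN /rv2_inj[]; rewrite !(mul0r, mul1r, add0r, mulr0, mulr1) => cE dE det1.
rewrite cE dE in PN det1 z2; rewrite mulr0 subr0 in det1.
have aE : a = m by apply: (mulIf (invr_neq0 m_n0)); rewrite det1 mulfV.
rewrite aE in PN z2.
have [C pp] : exists C, pingpong (fun i => SL2_mx (letter_eval (pair_gen M N) i)) C.
  apply: (@pingpong_transport M N P l 0 1 l^-1 m b 0 m^-1) => //.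
  - by rewrite mulfV // mul0r subr0.
  - by rewrite mulfV // mulr0 subr0.
  rewrite oppr0; apply: pingpong_pants => //.
  (* The trace of MN is lm + b + 1/(lm); multiplying the bound -2 by lm gives l m b <= -(1 +
     lm)^2. *)
  have -> : l * m * b = l * m * (l * m + 0 * 0 + (1 * b + l^-1 * m^-1)) - (l * m) ^+ 2 - 1.
    by field; rewrite ?l_n0 ?m_n0.
  move: (l * m + 0 * 0 + (1 * b + l^-1 * m^-1)) (l * m) (mulr_gt0 l0 m0) z2 => t p p0 t2; nra.
exact: pingpong_free_fuchsian pp comm2.
Qed.

End Domains.

(** * The Trace Minimization Algorithm *)

Section TraceTriples.
Variable K : realType.
Implicit Types (M N : SL2 K) (G : set (PSL2 K)) (a b c x y z sigma : K).

(** The invariant of the algorithm: permutations, sign changes and flips come from changing the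
    generating pair or its lifts, while the group [G] stays fixed. *)
Definition trace_triple_of G (t : K * K * K) : Prop :=
  exists M N, G = gen [set to_PSL2 M; to_PSL2 N] /\ t = (SL2_tr M, SL2_tr N, SL2_tr (M * N)%g).

Lemma gen2_eq (gT : groupType) (g h g' h' : gT) :
    gen [set g; h] g' -> gen [set g; h] h' -> gen [set g'; h'] g -> gen [set g'; h'] h ->
  gen [set g; h] = gen [set g'; h'].
Proof. by move=> *; apply: gen_eq => _ [] ->. Qed.

Lemma trace_triple_swap12 G a b c : trace_triple_of G (a, b, c) -> trace_triple_of G (b, a, c).
Proof.
by move=> [M [N [-> [-> -> ->]]]]; exists N, M; rewrite SL2_trMC setUC.
Qed.

(** The new generators are M^-1 and MN, whose product is N. *)
Lemma trace_triple_swap23 G a b c : trace_triple_of G (a, b, c) -> trace_triple_of G (a, c, b).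
Proof.
move=> [M [N [-> [-> -> ->]]]]; exists M^-1%g, (M * N)%g; rewrite mulKg SL2_trV; split=> //.
rewrite to_PSL2M to_PSL2V; move: (to_PSL2 M) (to_PSL2 N) => g h.
have [_ GM GV] := gen_subgroup [set g; h].
have [_ HM HV] := gen_subgroup [set (g^-1)%g; (g * h)%g].
have Hg : gen [set (g^-1)%g; (g * h)%g] g.
  by rewrite -[g in gen _ g]invgK; apply: HV; apply: sub_gen; left.
apply: gen2_eq => //.
- by apply: GV; apply: sub_gen; left.
- by apply: GM; apply: sub_gen; [left|right].
- by rewrite -[h in gen _ h](mulKg g); apply: HM; [apply: HV|apply: sub_gen; right].
Qed.

Lemma trace_triple_sign12 G a b c :
  trace_triple_of G (a, b, c) -> trace_triple_of G (- a, - b, c).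
Proof.
move=> [M [N [-> [-> -> ->]]]]; exists (SL2_opp M), (SL2_opp N).
by rewrite !to_PSL2N SL2_mulN SL2_mulNl SL2_oppK !SL2_trN.
Qed.

Lemma trace_triple_sign13 G a b c :
  trace_triple_of G (a, b, c) -> trace_triple_of G (- a, b, - c).
Proof. by move=> /trace_triple_swap23/trace_triple_sign12/trace_triple_swap23. Qed.

Lemma trace_triple_sign23 G a b c :
  trace_triple_of G (a, b, c) -> trace_triple_of G (a, - b, - c).
Proof. by move=> /trace_triple_swap12/trace_triple_sign13/trace_triple_swap12. Qed.

Lemma trace_triple_flip G a b c :
  trace_triple_of G (a, b, c) -> trace_triple_of G (a, b, a * b - c).
Proof.
move=> [M [N [-> [-> -> ->]]]]; exists M, N^-1%g; rewrite SL2_trMV SL2_trV; split=> //.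
rewrite to_PSL2V; move: (to_PSL2 M) (to_PSL2 N) => g h.
have [_ _ GV] := gen_subgroup [set g; h].
have [_ _ HV] := gen_subgroup [set g; (h^-1)%g].
apply: gen2_eq; do ?by apply: sub_gen; left.
- by apply: GV; apply: sub_gen; right.
- by rewrite -[h in gen _ h]invgK; apply: HV; apply: sub_gen; right.
Qed.

Lemma trace_triple_third G a b c : trace_triple_of G (a, b, c) ->
  exists M, G (to_PSL2 M) /\ c = SL2_tr M.
Proof.
move=> [M [N [-> [_ _ ->]]]]; exists (M * N)%g; split=> //; rewrite to_PSL2M.
by have [_ GM _] := gen_subgroup [set to_PSL2 M; to_PSL2 N]; apply: GM; apply: sub_gen; [left|right].
Qed.

Lemma perm2_cases (T : eqType) (a b a' b' : T) : perm_eq [:: a; b] [:: a'; b'] ->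
  (a' = a /\ b' = b) \/ (a' = b /\ b' = a).
Proof.
move=> p; have : a' \in [:: a; b] by rewrite (perm_mem p) mem_head.
rewrite !inE => /orP[]/eqP e; move: p; rewrite e.
  by rewrite perm_cons => /perm_small_eq -/(_ isT)[->]; left.
by rewrite (permPl (permEl (perm_catC [:: a] [:: b]))) perm_cons => /perm_small_eq -/(_ isT)[->]; right.
Qed.

Lemma perm3_ind (T : eqType) (P : T -> T -> T -> Prop) (a b c a' b' c' : T) :
    (forall u v w, P u v w -> P v u w) -> (forall u v w, P u v w -> P u w v) ->
  perm_eq [:: a; b; c] [:: a'; b'; c'] -> P a b c -> P a' b' c'.
Proof.
move=> P12 P23 p Pabc; have : a' \in [:: a; b; c] by rewrite (perm_mem p) mem_head.
rewrite !inE => /or3P[]/eqP e; move: p; rewrite e.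
- rewrite perm_cons => /perm2_cases[] [-> ->] //; exact: P23.
- rewrite (permPl (permEl (perm_catCA [:: a] [:: b] [:: c]))) perm_cons => /perm2_cases[] [-> ->].
    exact: P12.
  exact/P23/P12.
- rewrite (permPl (permEl (perm_catC [:: a; b] [:: c]))) perm_cons => /perm2_cases[] [-> ->].
    exact/P12/P23.
  exact/P23/P12/P23.
Qed.

Lemma trace_triple_perm G a b c a' b' c' :
    perm_eq [:: a; b; c] [:: a'; b'; c'] ->
  trace_triple_of G (a, b, c) -> trace_triple_of G (a', b', c').
Proof.
apply: (@perm3_ind _ (fun x y z => trace_triple_of G (x, y, z))) => x y z.
  exact: trace_triple_swap12.
exact: trace_triple_swap23.
Qed.

Lemma comm_tr_start sigma t t0 :
  tma_start sigma t t0 -> comm_tr_of_triple t0 = comm_tr_of_triple t.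
Proof.
case: t => [[x y] z] [[a [b [c [p t0abc]]]] _].
have -> : comm_tr_of_triple (x, y, z) = comm_tr_of_triple (a, b, c).
  apply: (@perm3_ind _ (fun u v w => comm_tr_of_triple (x, y, z) = comm_tr_of_triple (u, v, w))
            x y z) => // u v w ->; rewrite /comm_tr_of_triple; ring.
by move: t0abc; rewrite !inE => /or4P[] /eqP->; rewrite /comm_tr_of_triple; ring.
Qed.

Lemma trace_triple_seq G a b c (s : seq K) : perm_eq s [:: a; b; c] ->
  trace_triple_of G (a, b, c) -> trace_triple_of G (s`_0, s`_1, s`_2).
Proof.
move=> p; have := perm_size p; case: s p => [|a' [|b' [|c' [|]]]] //= p _.
by apply: trace_triple_perm; rewrite perm_sym.
Qed.

Lemma trace_triple_start G sigma t t0 :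
  tma_start sigma t t0 -> trace_triple_of G t -> trace_triple_of G t0.
Proof.
case: t => [[x y] z] [[a [b [c [/= p t0abc]]]] _] /(trace_triple_perm p) Gabc.
move: t0abc; rewrite !inE => /or4P[] /eqP->.
- by [].
- exact: trace_triple_sign12.
- exact: trace_triple_sign13.
- exact: trace_triple_sign23.
Qed.

Lemma trace_triple_loop G sigma t t1 :
  tma_loop sigma t t1 -> trace_triple_of G t -> trace_triple_of G t1.
Proof.
elim=> // {}t t' _ _ IH Gt; apply: IH; case: t Gt => [[x y] z] /trace_triple_flip.
by apply: trace_triple_seq; rewrite perm_sort.
Qed.

Lemma trace_triple_output G sigma t :
  trace_triple_of G t -> trace_triple_of G (tma_output sigma t).
Proof.
case: t => [[x y] z]; rewrite /tma_output; case: ifP => _; apply: trace_triple_seq.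
  by rewrite perm_sort.
set s := sort _ _; have ps : perm_eq s [:: x; y; z] by rewrite perm_sort.
apply: perm_trans ps.
have -> : [seq v <- s | v < 0] = [seq v <- s | predC (fun v => 0 <= v) v].
  by apply: eq_filter => v /=; rewrite ltNge.
by rewrite perm_filterC.
Qed.

Lemma trace_triple_tma G t t' : tma t t' -> trace_triple_of G t -> trace_triple_of G t'.
Proof.
move=> [_ [t0 [t1 [start loop ->]]]] Gt.
exact/trace_triple_output/(trace_triple_loop loop)/(trace_triple_start start).
Qed.

(** * Existence of a terminating run for commutator trace greater than 2 *)

Lemma sort3_eq a b c x y z : perm_eq [:: x; y; z] [:: a; b; c] -> a <= b -> b <= c ->
  sort3 x y z = (a, b, c).
Proof.
move=> p ab bc; rewrite /sort3.
have -> : sort <=%R [:: x; y; z] = [:: a; b; c].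
  apply: (sorted_eq le_trans le_anti); first exact: (sort_sorted le_total).
    by rewrite /= ab bc.
  by rewrite perm_sort.
by [].
Qed.

Lemma tma_output_eq sigma x y z t : 2 < sigma -> 0 <= x -> x <= y -> z < 0 ->
  perm_eq [:: t.1.1; t.1.2; t.2] [:: z; x; y] -> tma_output sigma t = (x, y, z).
Proof.
case: t => [[a b] c] /= sigma2 x0 xy z0 p; rewrite ltNge ltW //=.
have -> : sort <=%R [:: a; b; c] = [:: z; x; y].
  apply: (sorted_eq le_trans le_anti); first exact: (sort_sorted le_total).
    by rewrite /= xy (ltW (lt_le_trans z0 x0)).
  by rewrite perm_sort.
have y0 := le_trans x0 xy.
by rewrite /= z0 x0 y0 leNgt z0 !ltNge x0 y0.
Qed.

(** Sort by absolute value; one of the four admissible sign patterns makes the first two entries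
    nonnegative. *)
Lemma tma_start_exists sigma a b c : 2 < sigma -> exists t0, tma_start sigma (a, b, c) t0.
Proof.
move=> sigma2; pose s := sort (relpre (@Num.norm K K) <=%R) [:: a; b; c].
have ps : perm_eq [:: a; b; c] s by rewrite perm_sym perm_sort.
have : sorted (relpre (@Num.norm K K) <=%R) s.
  by apply: sort_sorted => u v; exact: le_total.
case: s ps (perm_size ps) => [|x [|y [|z [|]]]] //= p _ /and3P[xy yz _].
have start t0 : t0 \in [:: (x, y, z); (- x, - y, z); (- x, y, - z); (x, - y, - z)] ->
    t0.1 = (`|x|, `|y|) -> `|t0.2| = `|z| -> tma_start sigma (a, b, c) t0.
  move=> t0in t01 t02; split; first by exists x, y, z.
  case: t0 t0in t01 t02 => [[x0 y0] z0] _ [-> ->] ->; split=> //.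
  by move=> sigma_lt2; have := lt_trans sigma2 sigma_lt2; rewrite ltxx.
have [x0|x0] := leP 0 x; have [y0|y0] := leP 0 y.
- exists (x, y, z); apply: start => //=; first by rewrite mem_head.
  by rewrite !ger0_norm.
- exists (x, - y, - z); apply: start => /=; first by rewrite !inE eqxx !orbT.
    by rewrite ger0_norm // ltr0_norm.
  by rewrite normrN.
- exists (- x, y, - z); apply: start => /=; first by rewrite !inE eqxx !orbT.
    by rewrite ltr0_norm // ger0_norm.
  by rewrite normrN.
- exists (- x, - y, z); apply: start => //=; first by rewrite !inE eqxx !orbT.
  by rewrite !ltr0_norm.
Qed.

(** The decrease d = 2z - xy satisfies d^2 = 4 (sigma - 2) + (x^2 - 4)(y^2 - 4). If d <= 0, then -d
    <= y (x - 2), which makes d^2 too small; if 0 < d < e, then d^2 < e because e <= 1, again too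
    small. *)
Lemma flip_decrease x y z sigma e : 2 <= x -> x <= y -> y <= z ->
    comm_tr_of_triple (x, y, z) = sigma -> 0 < e -> e <= 1 -> e <= sigma - 2 ->
  e <= 2 * z - x * y.
Proof.
rewrite /comm_tr_of_triple => x2 xy yz <- e0 e1 e_sigma; set d := 2 * z - x * y.
have dE : d ^+ 2 = 4 * (x ^+ 2 + y ^+ 2 + z ^+ 2 - x * y * z - 2 - 2) +
    (x ^+ 2 - 4) * (y ^+ 2 - 4) by rewrite /d; ring.
have xy4 : 0 <= (x ^+ 2 - 4) * (y ^+ 2 - 4).
  by apply: mulr_ge0; nra.
have d0 : 0 < d.
  rewrite ltNge; apply/negP => d_le0.
  have dy : - d <= y * (x - 2) by rewrite /d; lra.
  have d2 : d ^+ 2 <= (y * (x - 2)) ^+ 2.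
    by rewrite -[d ^+ 2]sqrrN; apply: lerXn2r; rewrite ?nnegrE //; lra.
  have : 0 <= (x - 2) * (4 * y ^+ 2 - 4 * x - 8) by apply: mulr_ge0; nra.
  by rewrite dE in d2; lra.
rewrite leNgt; apply/negP => de; have : d ^+ 2 < e by nra.
by rewrite dE; lra.
Qed.

(** Induction on the number n of steps of size e by which the sum may exceed 6, its least value for
    entries at least 2. The flipped entry is a trace of an element of [G]: if negative it is at most
    -2 and the loop stops, otherwise it is at least 2 and the loop continues with a smaller sum. *)
Lemma tma_loop_exists G sigma e n x y z :
    (forall M, G (to_PSL2 M) -> 2 <= `|SL2_tr M|) -> 0 < e -> e <= 1 -> e <= sigma - 2 ->
    2 <= x -> x <= y -> y <= z -> comm_tr_of_triple (x, y, z) = sigma ->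
    trace_triple_of G (x, y, z) -> x + y + z < 6 + n%:R * e ->
  exists t1 x' y' z', [/\ tma_loop sigma (x, y, z) t1, tma_output sigma t1 = (x', y', z'),
    2 <= x', 2 <= y' & z' <= -2].
Proof.
move=> Gtr e0 e1 e_sigma; elim: n x y z => [|n IHn] x y z x2 xy yz comm_sigma Gxyz.
  by rewrite mul0r => sum_lt; exfalso; lra.
rewrite -[n.+1%:R]natr1 mulrDl mul1r => sum_lt.
have sigma2 : 2 < sigma by lra.
have dec := flip_decrease x2 xy yz comm_sigma e0 e1 e_sigma.
have Gw := trace_triple_flip Gxyz; set w := x * y - z in Gw.
have comm_w : comm_tr_of_triple (x, y, w) = sigma by rewrite -comm_sigma /comm_tr_of_triple /w; ring.
have w2 : 2 <= `|w| by have [M [GM ->]] := trace_triple_third Gw; exact: Gtr.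
have sigma_nlt : (sigma < 2) = false by rewrite ltNge ltW.
have nonneg_nstop a b c : 2 <= a -> 2 <= b -> 2 <= c -> ~~ tma_stop sigma (a, b, c).
  by move=> a2 b2 c2; rewrite /tma_stop sigma_nlt !negb_or -!leNgt; apply/and3P; split; lra.
have nstop : ~~ tma_stop sigma (x, y, z) by apply: nonneg_nstop; lra.
have next a b c : perm_eq [:: x; y; w] [:: a; b; c] -> 2 <= a -> a <= b -> b <= c ->
    comm_tr_of_triple (a, b, c) = sigma -> a + b + c = x + y + w ->
    exists t1 x' y' z', [/\ tma_loop sigma (x, y, z) t1, tma_output sigma t1 = (x', y', z'),
    2 <= x', 2 <= y' & z' <= -2].
  move=> p a2 ab bc comm_abc sumE.
  have [||t1 [x' [y' [z' [loop out x'2 y'2 z'2]]]]] := IHn _ _ _ a2 ab bc comm_abc.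
  - exact: trace_triple_perm Gw.
  - by rewrite sumE /w; lra.
  exists t1, x', y', z'; split=> //; apply: TmaStep => //.
  by rewrite /tma_step -/w (sort3_eq p).
have [w0|w0] := ltP w 0; last first.
  rewrite ger0_norm // in w2.
  have [wx|xw] := leP w x.
    apply: (next w x y) => //; [|rewrite -comm_w /comm_tr_of_triple; ring|ring].
    exact: permEl (perm_catC [:: x; y] [:: w]).
  have [wy|yw] := leP w y.
    apply: (next x w y) => //; [|exact: ltW|rewrite -comm_w /comm_tr_of_triple; ring|ring].
    by rewrite perm_cons; exact: permEl (perm_catC [:: y] [:: w]).
  by apply: (next x y w) => //; exact: ltW.
exists (w, x, y), x, y, w.
have w_le : w <= - 2 by rewrite ltr0_norm // in w2; lra.
split=> //; last by lra.
- apply: TmaStep => //; rewrite /tma_step -/w (@sort3_eq w x y) //; last by lra.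
    by apply: TmaStop; rewrite /tma_stop sigma_nlt w0.
  exact: permEl (perm_catC [:: x; y] [:: w]).
- by apply: tma_output_eq => //=; lra.
Qed.

Lemma tma_exists G x y z :
    (forall M, G (to_PSL2 M) -> 2 <= `|SL2_tr M|) ->
    2 < comm_tr_of_triple (x, y, z) -> trace_triple_of G (x, y, z) ->
  exists x' y' z', tma (x, y, z) (x', y', z') /\ [/\ 2 <= x', 2 <= y' & z' <= -2].
Proof.
move=> Gtr; set sigma := comm_tr_of_triple (x, y, z) => sigma2 Gxyz.
have [[[a b] c] start] := tma_start_exists x y z sigma2.
have Gabc := trace_triple_start start Gxyz.
have third p q r : trace_triple_of G (p, q, r) -> 2 <= `|r|.
  by case/trace_triple_third => M [GM ->]; exact: Gtr.
have a2 : 2 <= `|a| by apply: third (trace_triple_swap23 (trace_triple_swap12 Gabc)).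
have c2 : 2 <= `|c| by apply: third Gabc.
have comm_abc : comm_tr_of_triple (a, b, c) = sigma by rewrite (comm_tr_start start).
have [_ [_ /(_ sigma2) a0 ab bc]] := start.
rewrite ger0_norm // in a2.
have sigma_n2 : sigma != 2 by rewrite gt_eqF.
suff [t1 [x' [y' [z' [loop out x'2 y'2 z'2]]]]] : exists t1 x' y' z',
    [/\ tma_loop sigma (a, b, c) t1, tma_output sigma t1 = (x', y', z'),
    2 <= x', 2 <= y' & z' <= -2].
  exists x', y', z'; split=> //; split=> //; exists (a, b, c), t1; split=> //.
have [c0|c0] := ltP c 0.
  exists (a, b, c), a, b, c.
  have c_le : c <= - 2 by rewrite ltr0_norm // in c2; lra.
  split=> //; last exact: le_trans ab.
  - by apply: TmaStop; rewrite /tma_stop ltNge ltW //= c0 !orbT.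
  - apply: tma_output_eq => //=.
    exact: permEl (perm_catC [:: a; b] [:: c]).
rewrite ger0_norm // in bc.
(* A uniform lower bound for the decrease in one flip; the Archimedean property then bounds the
   number of flips. *)
pose e := Num.min 1 (sigma - 2).
have e0 : 0 < e by rewrite lt_min ltr01 subr_gt0.
have e1 : e <= 1 by rewrite ge_min lexx.
have e_sigma : e <= sigma - 2 by rewrite ge_min lexx orbT.
have sum6 : 0 <= (a + b + c - 6) / e by rewrite divr_ge0 ?(ltW e0) //; lra.
apply: (tma_loop_exists (n := Num.bound ((a + b + c - 6) / e)) Gtr e0 e1 e_sigma) => //.
have := archi_boundP sum6; rewrite ltr_pdivrMr //; lra.
Qed.

End TraceTriples.

(** * The classification *)

Lemma free_fuchsian_tr_ge2 (K : realType) (n : nat) (G : set (PSL2 K)) (M : SL2 K) :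
  free_fuchsian n G -> G (to_PSL2 M) -> 2 <= `|SL2_tr M|.
Proof.
move=> [[subG discG _] freeG]; apply: discrete_tr_ge2 => // g m Gg m0.
exact: free_torsion_free freeG Gg m0.
Qed.

Unset Implicit Arguments.

(* MR and MS are the representatives of R and S with non-negative trace.     *)
Theorem theorem6p1 (K : realType) (A B : PSL2 K) (p q p' q' : nat)
    (R S : PSL2 K) (MR MS : SL2 K) (x y z tau : K)
    (hAB : free_fuchsian 2 (gen [set A; B]))
    (hp : (0 < p)%N) (hq : (0 < q)%N) (hp' : (0 < p')%N) (hq' : (0 < q')%N)
    (hpq : coprime p q) (hpq' : coprime p' q')
    (hR : (R ^+ p)%g = (A ^+ q)%g) (hS : (S ^+ p')%g = (B ^+ q')%g)
    (hMR : to_PSL2 MR = R) (hMR0 : 0 <= SL2_tr MR)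
    (hMS : to_PSL2 MS = S) (hMS0 : 0 <= SL2_tr MS)
    (hx : x = SL2_tr MR) (hy : y = SL2_tr MS) (hz : z = SL2_tr (MR * MS)%g)
    (htau : tau = comm_tr (A ^+ q)%g (B ^+ q')%g) :
  free_fuchsian 2 (gen [set R; S]) <->
    (tau <= -2 /\
     (chebS K p).[x] ^+ 2 * (chebS K p').[y] ^+ 2 <= 1 / 2 - 1 / 4 * tau)
    \/
    (tau > 2 /\
     exists x' y' z' : K,
       tma (x, y, z) (x', y', z') /\ [/\ 2 <= x', 2 <= y' & z' <= -2]).
Proof.
have sigmaE : SL2_tr (MR * MS * MR^-1 * MS^-1)%g = comm_tr_of_triple (x, y, z).
  by rewrite hx hy hz SL2_tr_comm.
have triple : trace_triple_of (gen [set R; S]) (x, y, z).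
  by exists MR, MS; rewrite hMR hMS hx hy hz.
set sigma := comm_tr_of_triple (x, y, z) in sigmaE.
set X := (chebS K p).[x]; set Y := (chebS K p').[y].
have tauE : tau - 2 = X ^+ 2 * Y ^+ 2 * (sigma - 2).
  rewrite htau -hR -hS -hMR -hMS -!to_PSL2X comm_trE -(prednK hp) -(prednK hp') comm_tr_expg.
  by rewrite !prednK // -hx -hy sigmaE.
have P_ge0 : 0 <= X ^+ 2 * Y ^+ 2 by rewrite mulr_ge0 ?sqr_ge0.
have [P PE] : exists P, P = X ^+ 2 * Y ^+ 2 by eexists.
rewrite -PE in tauE P_ge0 *.
split=> [ffG|[[tau_le P_le]|[tau_gt [x' [y' [z' [tmaE [x2 y2 z2]]]]]]]].
- have [[_ GM GV] _ nonelem] := ffG.1.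
  have GR : gen [set R; S] (to_PSL2 MR) by rewrite hMR; apply: sub_gen; left.
  have GS : gen [set R; S] (to_PSL2 MS) by rewrite hMS; apply: sub_gen; right.
  have Gtr M := @free_fuchsian_tr_ge2 _ _ _ M ffG.
  have x2 : 2 <= x by have := Gtr _ GR; rewrite -hx ger0_norm // hx.
  have y2 : 2 <= y by have := Gtr _ GS; rewrite -hy ger0_norm // hy.
  have sigma2 : 2 <= `|sigma|.
    rewrite -sigmaE; apply: Gtr; rewrite !to_PSL2M !to_PSL2V.
    exact: (GM _ _ (GM _ _ (GM _ _ GR GS) (GV _ GR)) (GV _ GS)).
  have sigma_neq2 : sigma != 2.
    apply/eqP => sigma_eq2; apply: nonelem; apply: comm_tr2_elementary.
    by rewrite -hMR -hMS comm_trE sigmaE.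
  (* For traces at least 2, S_p(x) >= p >= 1, and likewise for the other factor. *)
  have P_ge1 : 1 <= P.
    have X1 : 1 <= X by rewrite (le_trans _ (chebS_ge p x2)) ?ler1n.
    have Y1 : 1 <= Y by rewrite (le_trans _ (chebS_ge p' y2)) ?ler1n.
    by rewrite PE -[1]mulr1; apply: ler_pM; rewrite ?expr_ge1 ?ler01 // (le_trans ler01).
  move: sigma2; rewrite ler_normr => /orP[sigma2|sigma2]; [right|left].
    have sigma_gt2 : 2 < sigma by rewrite lt_neqAle eq_sym sigma_neq2.
    split; last exact: tma_exists Gtr sigma_gt2 triple.
    have : 0 < P * (sigma - 2) by apply: mulr_gt0; lra.
    lra.
  (* With 2 - tau = P (2 - sigma), this inequality gives tau <= sigma <= -2, and the next one gives
     4 P <= 2 - tau, which is the bound of F1. *)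
  have : 0 <= (P - 1) * (2 - sigma) by apply: mulr_ge0; lra.
  have : 0 <= P * (- 2 - sigma) by apply: mulr_ge0; lra.
  by split; lra.
- rewrite -hMR -hMS; apply: torus_free_fuchsian => //.
  rewrite sigmaE leNgt; apply/negP => sigma_gt.
  (* P = 0 would give tau = 2. For P > 0 the bound 4 P <= 2 - tau = P (2 - sigma) is incompatible
     with sigma > -2. *)
  have P_gt0 : 0 < P.
    rewrite lt_neqAle P_ge0 andbT; apply/eqP => P0; move: tauE; rewrite -P0 mul0r; lra.
  have : 0 < P * (sigma + 2) by apply: mulr_gt0; lra.
  lra.
(* The minimized triple is the trace triple of another generating pair of the same group, to which
   the pair of pants argument applies. *)
- have [M [N [-> [x'E y'E z'E]]]] := trace_triple_tma tmaE triple.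
  by apply: pants_free_fuchsian; rewrite -?x'E -?y'E -?z'E.
Qed.
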